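(* Let $\alpha>0$ and $\nu>-1$. Then for $z\in\mathbb C$ $$e^{-\alpha z/4}z^{\nu/2}=\frac{\alpha^2}{3\pi2^{3+\nu}}\int_{\mathbb C}u^{\nu/2}\,I_\nu\left(\frac\alpha2\sqrt{z\overline u}\right)e^{-\frac16\alpha\,\mathrm{Re}\,u}\,K_\nu\left(\frac{\alpha|u|}{3}\right)d\sigma(u).$$
   Context: $I_\nu$ is the modified Bessel function of the first kind, $K_\nu$ is the MacDonald function (modified Bessel function of the second kind), $d\sigma$ is planar Lebesgue measure on $\mathbb C$. Branches of roots and powers are principal, taken consistently: $\sqrt{z\overline u}=\sqrt z\,\overline{\sqrt u}$, $z^{\nu/2}=(\sqrt z)^\nu$, $u^{\nu/2}=(\sqrt u)^\nu$, and in $I_\nu(w)=w^\nu\cdot(\text{even entire function of }w)$ one takes $(\sqrt z\,\overline{\sqrt u})^\nu=(\sqrt z)^\nu\,\overline{(\sqrt u)^\nu}$ (equivalently, the identity is understood after cancelling $z^{\nu/2}$, where both sides become entire in $z$). *)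

(* Defs.v *)
From mathcomp Require Import all_boot all_order all_algebra.
From mathcomp Require Import all_classical all_reals all_analysis.
From mathcomp Require Import complex.
Import Order.TTheory GRing.Theory Num.Theory numFieldNormedType.Exports.

Set Implicit Arguments.
Unset Strict Implicit.
Unset Printing Implicit Defensive.

Local Open Scope classical_set_scope.
Local Open Scope ring_scope.
Local Open Scope complex_scope.

Section ComplexElementary.
Context {R : realType}.
Implicit Types (w : R[i]) (a : R).

Definition cmod w : R := Num.sqrt (complex.Re w ^+ 2 + complex.Im w ^+ 2).

(* Principal argument, with values in ]-pi, pi]. *)
Definition carg w : R :=
  let t := acos (complex.Re w / cmod w) in
  if complex.Im w < 0 then - t else t.

Definition cexp w : R[i] :=
  (expR (complex.Re w))%:C * (cos (complex.Im w) +i* sin (complex.Im w)).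

(* Principal logarithm; meaningful for w != 0 only. *)
Definition clog w : R[i] := ln (cmod w) +i* carg w.

(* Principal power w^a with a real exponent; at w = 0 it follows the
   convention of powR: 0^0 = 1 and 0^a = 0 for every a != 0, even a < 0. *)
Definition cpow w a : R[i] :=
  if w == 0 then (a == 0)%:R else cexp (a%:C * clog w).

End ComplexElementary.

Section ComplexIntegral.
Context {R : realType}.
Implicit Type f : R[i] -> R[i].

(* Planar Lebesgue measure, C being identified with R * R. *)
Definition planar_measure := ((@lebesgue_measure R) \x (@lebesgue_measure R))%E.

Definition cintegrable f : Prop :=
  planar_measure.-integrable setT
    (fun p => (complex.Re (f (p.1 +i* p.2)))%:E) /\
  planar_measure.-integrable setT
    (fun p => (complex.Im (f (p.1 +i* p.2)))%:E).

Definition cintegral f : R[i] :=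
  (\int[planar_measure]_p complex.Re (f (p.1 +i* p.2))) +i*
  (\int[planar_measure]_p complex.Im (f (p.1 +i* p.2))).

End ComplexIntegral.

Section Bessel.
Context {R : realType}.
Implicit Types (nu x : R) (w : R[i]).

(* Euler's Gamma function, for x > 0. *)
Definition Gamma x : R :=
  \int[lebesgue_measure]_(t in `]0, +oo[) (t `^ (x - 1) * expR (- t)).

(* The even entire factor I_nu(w) / w^nu, for nu > -1:
     2^-nu * sum_k (w / 2)^(2 k) / (k! Gamma(nu + k + 1)).
   The limit is taken in the normed topology of R[i]. *)
Definition besselI_even nu w : R[i] :=
  (2 `^ (- nu))%:C *
  limn (series ((fun k => (w / 2) ^+ (2 * k) /
                          (k`!%:R * Gamma (nu + k%:R + 1))%:C)
                : nat -> R[i]^o)).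

(* Modified Bessel function of the first kind, principal branch. *)
Definition besselI nu w : R[i] := cpow w nu * besselI_even nu w.

Definition cosh x : R := (expR x + expR (- x)) / 2.

(* Macdonald function K_nu(x) for x > 0, by
     K_nu(x) = int_0^oo exp(- x cosh t) cosh(nu t) dt,
   which covers integer and non-integer orders uniformly. *)
Definition besselK nu x : R :=
  \int[lebesgue_measure]_(t in `[0, +oo[) (expR (- (x * cosh t)) * cosh (nu * t)).

End Bessel.

(* Main.v *)
Require Import Defs.
From HB Require Import structures.
From mathcomp Require Import all_boot all_order all_algebra.
From mathcomp Require Import all_classical all_reals all_analysis.
From mathcomp Require Import complex measurable_realfun ring lra.
Import Order.TTheory GRing.Theory Num.Theory numFieldNormedType.Exports.

Set Implicit Arguments.
Unset Strict Implicit.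
Unset Printing Implicit Defensive.

Local Open Scope classical_set_scope.
Local Open Scope ring_scope.
Local Open Scope complex_scope.

(** The substitution [s = t + ln (r / 2)] in the integral defining [K_nu r] gives
      [2 (r / 2)^nu K_nu(r) = int exp (nu s - e^s - (r / 2)^2 e^(-s)) ds] over the real line,
    so that [|u|^nu K_nu(alpha |u| / 3)] is a mixture over [s] of the Gaussians
    [exp (- b |u|^2)] with [b = (alpha / 6)^2 e^(-s)].  For fixed [s] the moments
    of [exp (- a Re u - b |u|^2)] against [conj u ^ k] form a geometric sequence of
    ratio [- a / (2 b)], by integration by parts.  Integrating over [s] then produces
    [Gamma (nu + k + 1)], which cancels the denominators of the series of [I_nu];
    what is left is the exponential series of [- alpha z / 4].  The exchanges of
    sums and integrals rest on one integrable function dominating all the partial sums.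

    Everything is proved for [Re (e w)] with an arbitrary complex factor [e], which
    covers real and imaginary parts at once. *)

(** * Integrals over the real line *)

Section RealIntegrals.
Context {R : realType}.
Implicit Types (f g : R -> R) (c x s : R).
Notation mu := (@lebesgue_measure R).

(** The obstacle is domination. The factor [exp (- alpha Re u / 6)] can grow like
    [exp (alpha |u| / 6)], while [K_nu (alpha |u| / 3)] decays like [exp (- alpha |u| / 3)], so only
    a margin [alpha / 6] remains for the series of [I_nu]. That series, in powers of [z conj u],
    grows more slowly than any exponential of [|u|]: the bound [Gamma x >= exp (x m - e^(m + 1))]
    with [m] free lets all partial sums be bounded by a constant times
    [exp (alpha / 12 (|x| + |y|))], [u = x + i y]. The Gaussian integral with this extra factor is
    still beaten by [exp (- e^s)].

    The moments are geometric because [conj u ^ k] is antiholomorphic: in the integration by parts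
    the terms lowering [k] carry the factor [1 + i^2 = 0].

    Since [(sqrt u)^nu conj ((sqrt u)^nu) = |u|^nu], the factor [z^(nu/2)] comes out of the
    integral. The cancelled identity is therefore the one to prove, and the original is a multiple
    of it. The mixture formula for [K_nu] fails at [u = 0], a null set that has to be removed
    explicitly. *)

Lemma lt0_bigcup_expR_itv :
  `]0, +oo[%classic = \bigcup_n `[expR (- n%:R), expR n%:R]%classic :> set R.
Proof.
apply/seteqP; split => [t|t [n _]] /=; rewrite !in_itv/= ?andbT.
  move=> t0; exists (Num.truncn `|ln t|).+1 => //=.
  have [y ty] := expR_total t0; rewrite -ty expRK in_itv/= !ler_expR -ler_norml.
  by rewrite ltW// truncnS_gt.
by move=> /andP[+ _]; apply: lt_le_trans; exact: expR_gt0.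
Qed.

Lemma bigcup_symmetric_itv :
  [set: R] = \bigcup_n `[(- n%:R), n%:R]%classic :> set R.
Proof.
apply/seteqP; split => // t _ /=; exists (Num.truncn `|t|).+1 => //=.
by rewrite in_itv/= -ler_norml ltW// truncnS_gt.
Qed.

(** The compact intervals [[e^(-n), e^n]] and [[-n, n]] correspond under [expR] and exhaust the two
    domains; monotone convergence then gives the equality in the extended reals, before any
    finiteness is known. *)
Lemma ge0_integral_expR_subst g :
  {in `]0%R, +oo[%classic, continuous g} -> (forall t, 0 < t -> 0 <= g t) ->
  (\int[mu]_(t in `]0%R, +oo[) (g t)%:E = \int[mu]_s (g (expR s) * expR s)%:E)%E.
Proof.
move=> cg g0.
have sub n : (`[expR (- n%:R), expR n%:R]%classic : set R) `<=` (`]0%R, +oo[%classic : set R).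
  by rewrite lt0_bigcup_expR_itv => t ht; exists n.
have mg : measurable_fun `](0 : R), +oo[ g.
  apply: subspace_continuous_measurable_fun => //.
  exact: continuous_in_subspaceT.
have cge : continuous (fun s => g (expR s) * expR s).
  move=> s; apply: (@continuousM _ R^o); last exact: continuous_expR.
  apply: continuous_comp; first exact: continuous_expR.
  by apply: cg; rewrite inE/= in_itv/= andbT expR_gt0.
have E n : (\int[mu]_(t in `[expR (- n%:R), expR n%:R]) (g t)%:E =
    \int[mu]_(s in `[(- n%:R)%R, n%:R]) (g (expR s) * expR s)%:E)%E.
  have dE : (@expR R)^`()%classic = expR by apply/funext => s; rewrite derive1E derive_val.
  rewrite integration_by_substitution_increasing//.
  - by apply: eq_integral => s _ /=; rewrite dE.
  - by rewrite lerNl (le_trans _ (ler0n R n))// oppr_le0.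
  - by move=> s t _ _; rewrite ltr_expR.
  - by rewrite dE => s _; exact: continuous_expR.
  - by rewrite dE; apply: cvgP; apply: cvg_at_right_filter; exact: continuous_expR.
  - by rewrite dE; apply: cvgP; apply: cvg_at_left_filter; exact: continuous_expR.
  - split; [by move=> s _; exact: derivable_expR| |].
    + by apply: cvg_at_right_filter; exact: continuous_expR.
    + by apply: cvg_at_left_filter; exact: continuous_expR.
  - apply: continuous_in_subspaceT => t /[!inE] /sub ht.
    by apply: cg; rewrite inE.
have nd1 : nondecreasing_seq (fun n => `[expR (- n%:R), expR n%:R]%classic : set R).
  move=> m n mn; apply/subsetPset => t /=; rewrite !in_itv/= => /andP[h1 h2].
  by rewrite (le_trans _ h1) ?(le_trans h2)// ler_expR ?lerN2 ler_nat.
have nd2 : nondecreasing_seq (fun n => `[(- n%:R), n%:R]%classic : set R).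
  move=> m n mn; apply/subsetPset => t /=; rewrite !in_itv/= => /andP[h1 h2].
  by rewrite (le_trans _ h1) ?(le_trans h2)// ?lerN2 ler_nat.
have h1 : (\int[mu]_(t in `[expR (- n%:R), expR n%:R]) (g t)%:E @[n --> \oo]
    --> \int[mu]_(t in `]0%R, +oo[) (g t)%:E)%E.
  rewrite lt0_bigcup_expR_itv; apply: ge0_nondecreasing_set_cvg_integral => //.
  - by move=> n; apply/measurable_EFinP; apply: measurable_funS mg.
  - by move=> n t /sub /=; rewrite in_itv/= andbT lee_fin; exact: g0.
have h2 : (\int[mu]_(s in `[(- n%:R)%R, n%:R]) (g (expR s) * expR s)%:E @[n --> \oo]
    --> \int[mu]_s (g (expR s) * expR s)%:E)%E.
  rewrite bigcup_symmetric_itv; apply: ge0_nondecreasing_set_cvg_integral => //.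
  - move=> n; apply/measurable_EFinP; apply: measurable_funTS.
    exact: continuous_measurable_fun.
  - by move=> n t _; rewrite lee_fin mulr_ge0 ?expR_ge0// g0 ?expR_gt0.
by move: h1; under eq_fun do rewrite E; move=> h1; exact: cvg_unique h1 h2.
Qed.

Lemma ge0_integral_shift f c : continuous f -> (forall x, 0 <= f x) ->
  (\int[mu]_x (f x)%:E = \int[mu]_x (f (x + c))%:E)%E.
Proof.
move=> cf f0.
have dE : (fun x : R => x + c)^`()%classic = cst 1 :> (R -> R).
  by apply/funext => x; rewrite derive1E deriveD// derive_id derive_cst addr0.
rewrite (@increasing_ge0_integration_by_substitutionT _ (fun x => x + c))//.
- by apply: eq_integral => x _ /=; rewrite dE /= [(_ * _)%R]mulr1.
- by move=> x y; rewrite ltrD2r.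
- by rewrite dE => x; exact: cst_continuous.
- by rewrite dE; exact: is_cvg_cst.
- by rewrite dE; exact: is_cvg_cst.
- exact: cvg_addrr_Ny.
- exact: cvg_addrr.
Qed.

Lemma ge0_integral_fold f : continuous f -> (forall x, 0 <= f x) ->
  (\int[mu]_x (f x)%:E =
   \int[mu]_(x in `[0%R, +oo[) (f x)%:E + \int[mu]_(x in `[0%R, +oo[) (f (- x))%:E)%E.
Proof.
move=> cf f0.
have mf : measurable_fun [set: R] f by exact: continuous_measurable_fun.
rewrite -(setUv `[0, +oo[%classic) ge0_integral_setU//=; last 4 first.
  exact: measurableC.
  by rewrite setUv; exact/measurable_EFinP.
  by move=> x _; rewrite lee_fin.
  exact/disj_setPCl.
congr (_ + _)%E.
rewrite setCitvr integral_itv_bndo_bndc; last exact/measurable_EFinP/measurable_funTS.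
rewrite -{1}oppr0 ge0_integration_by_substitutionNy//.
exact: continuous_subspaceT.
Qed.

Lemma integral_expRN_lty c : 0 < c ->
  (\int[mu]_(x in `[0%R, +oo[) (expR (- (c * x)))%:E < +oo)%E.
Proof.
move=> c0; have : (\int[mu]_(x in `[0%R, +oo[) (c * expR (- c * x))%:E = 1)%E.
  rewrite integral_mkcond -(integral_exponential_pdf c0); apply: eq_integral => x _.
  by rewrite /exponential_pdf !patchE; case: ifP.
under eq_integral do rewrite EFinM mulNr.
rewrite ge0_integralZl_EFin//; last 2 first.
  apply/measurable_EFinP; apply: measurable_funTS; apply: measurableT_comp => //.
  by apply: measurableT_comp => //; exact: measurable_funM.
  exact: ltW.
case: (integral _ _ _) => [r| |] //=; rewrite ?ltry//.
by rewrite mulry gtr0_sg// mul1e.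
Qed.

End RealIntegrals.

(** * Gamma and Macdonald functions *)

Section BesselKernel.
Context {R : realType}.
Implicit Types (c q r x s : R).
Notation mu := (@lebesgue_measure R).

Lemma continuous_expR_kernel x c q :
  continuous (fun s => expR (x * s - c * expR s - q * expR (- s))).
Proof.
move=> s; apply: continuous_comp; last exact: continuous_expR.
apply: (@continuousB _ R^o); first apply: (@continuousB _ R^o).
- by apply: (@continuousM _ R^o); [exact: cst_continuous|exact: cvg_id].
- by apply: (@continuousM _ R^o); [exact: cst_continuous|exact: continuous_expR].
- apply: (@continuousM _ R^o); first exact: cst_continuous.
  apply: continuous_comp; last exact: continuous_expR.
  by apply: (@continuousN _ R^o); exact: cvg_id.
Qed.

Lemma measurable_expRN c : measurable_fun [set: R] (fun s => expR (- (c * s))).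
Proof.
apply: continuous_measurable_fun.
have := @continuous_expR_kernel (- c) 0 0.
by under eq_fun do rewrite !mul0r !subr0 mulNr.
Qed.

(** At [+oo] the term [e^s] beats [x s]; at [-oo] the factor [e^(x s)] decays because [x > 0]. The
    two half-lines are compared with decaying exponentials separately. *)
Lemma integral_expR_kernel_lty x : 0 < x ->
  (\int[mu]_s (expR (x * s - expR s))%:E < +oo)%E.
Proof.
move=> x0.
have cf : continuous (fun s => expR (x * s - expR s)).
  have := @continuous_expR_kernel x 1 0.
  by under eq_fun do rewrite mul1r mul0r subr0.
rewrite ge0_integral_fold//.
apply: lte_add_pinfty.
- apply: (@le_lt_trans _ _ (\int[mu]_(s in `[0%R, +oo[)
    (expR ((x + 1) ^+ 2 / 2) * expR (- (1 * s)))%:E)%E).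
    apply: ge0_le_integral => //.
    + by apply/measurable_EFinP; apply: measurable_funTS; exact: continuous_measurable_fun.
    + apply/measurable_EFinP; apply: measurable_funTS; apply: measurable_funM => //.
      exact: measurable_expRN.
    + move=> s /=; rewrite in_itv/= andbT => s0.
      rewrite lee_fin -expRD ler_expR.
      (* From [e^s >= 1 + s^2 / 2] and [(x + 1 - s)^2 >= 0] follows
         [x s - e^s <= (x + 1)^2 / 2 - s]. *)
      have := expR_ge1Dxn 1 s0; rewrite (_ : 2`!%:R = 2)// => h.
      have := sqr_ge0 (x + 1 - s).
      nra.
  under eq_integral do rewrite EFinM.
  rewrite ge0_integralZl_EFin//.
    by rewrite lte_mul_pinfty ?lee_fin ?expR_ge0// integral_expRN_lty.
  apply/measurable_EFinP; apply: measurable_funTS.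
  exact: measurable_expRN.
- apply: le_lt_trans (integral_expRN_lty x0).
  apply: ge0_le_integral => //.
  + apply/measurable_EFinP; apply: measurable_funTS; apply: continuous_measurable_fun.
    by move=> s; apply: continuous_comp (cf _); exact: (@continuousN _ R^o).
  + apply/measurable_EFinP; apply: measurable_funTS.
    exact: measurable_expRN.
  + move=> s _; rewrite lee_fin ler_expR mulrN lerBlDr lerDl.
    exact: expR_ge0.
Qed.

(** Shifting [s] by [- ln c] normalises the rate to 1 at the price of [c^(-x)]; then [t = e^s] gives
    Euler's integral. *)
Lemma integral_expR_kernel_Gamma x c : 0 < x -> 0 < c ->
  (\int[mu]_s (expR (x * s - c * expR s))%:E = (Gamma x * c `^ (- x))%:E)%E.
Proof.
move=> x0 c0.
have cf : continuous (fun s => expR (x * s - c * expR s)).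
  have := @continuous_expR_kernel x c 0.
  by under eq_fun do rewrite mul0r subr0.
rewrite (@ge0_integral_shift _ _ (- ln c))//.
have E s : expR (x * (s - ln c) - c * expR (s - ln c)) =
    c `^ (- x) * expR (x * s - expR s).
  rewrite expRB lnK ?posrE// mulrCA divff ?gt_eqF// mulr1 /powR gt_eqF//.
  by rewrite -expRD; congr expR; ring.
under eq_integral do rewrite E EFinM.
rewrite ge0_integralZl_EFin//; last 2 first.
  apply/measurable_EFinP; apply: continuous_measurable_fun.
  have := @continuous_expR_kernel x 1 0.
  by under eq_fun do rewrite mul1r mul0r subr0.
  exact: powR_ge0.
rewrite mulrC EFinM; congr (_ * _)%E.
have fin : (\int[mu]_s (expR (x * s - expR s))%:E \is a fin_num)%E.
  rewrite ge0_fin_numE ?integral_expR_kernel_lty//.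
  by apply: integral_ge0 => s _; rewrite lee_fin expR_ge0.
rewrite -(fineK fin) /Gamma /Rintegral; congr (fine _)%:E.
rewrite (@ge0_integral_expR_subst _ (fun u : R => u `^ (x - 1) * expR (- u))); last 2 first.
- move=> t; rewrite inE/= in_itv/= andbT => t0.
  have : {for (t : R), continuous (fun u : R => u `^ (x - 1) * expR (- u))}; last by [].
  apply: (@continuousM _ R^o); last first.
    apply: continuous_comp; last exact: continuous_expR.
    by apply: (@continuousN _ R^o); exact: cvg_id.
  apply/differentiable_continuous/derivable1_diffP.
  by have [] := is_derive1_powR (x - 1) t0.
- by move=> t _; rewrite mulr_ge0 ?powR_ge0 ?expR_ge0.
apply: eq_integral => s _; congr _%:E.
by rewrite -expRM -!expRD; congr expR; ring.
Qed.


(** Keeps only the window [[m, m + 1]] of the integral over [s]. The parameter [m] is left free: it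
    is the exponential growth rate in [x], so [Gamma] outgrows every geometric sequence. *)
Lemma Gamma_ge_expR x m : 0 < x -> expR (x * m - expR (m + 1)) <= Gamma x.
Proof.
move=> x0.
have cf : continuous (fun s => expR (x * s - 1 * expR s)).
  have := @continuous_expR_kernel x 1 0.
  by under eq_fun do rewrite mul0r subr0.
have -> : Gamma x = Gamma x * 1 `^ (- x) by rewrite powR1 mulr1.
rewrite -lee_fin -integral_expR_kernel_Gamma//.
apply: (@le_trans _ _ (\int[mu]_(s in `[m, (m + 1)%R]) (expR (x * s - 1 * expR s))%:E)%E);
    last first.
  apply: ge0_subset_integral => //.
  by apply/measurable_EFinP; exact: continuous_measurable_fun.
apply: (@le_trans _ _ (\int[mu]_(s in `[m, (m + 1)%R]) (expR (x * m - expR (m + 1)))%:E)%E).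
  rewrite integral_cst//= lebesgue_measure_itv/= lte_fin ltrDl ltr01.
  by rewrite -EFinD addrAC subrr add0r mule1.
apply: ge0_le_integral => //.
  by apply/measurable_EFinP; apply: measurable_funTS; exact: continuous_measurable_fun.
move=> s /=; rewrite in_itv/= => /andP[ms sm].
rewrite lee_fin ler_expR mul1r lerB ?ler_expR//.
by rewrite ler_wpM2l// ltW.
Qed.

Lemma Gamma_gt0 x : 0 < x -> 0 < Gamma x.
Proof. by move=> x0; exact: lt_le_trans (expR_gt0 _) (Gamma_ge_expR 0 x0). Qed.

(** The shift by [ln (r / 2)] turns [e^s + (r / 2)^2 e^(-s)] into [r cosh s]; folding the line onto
    [[0, +oo[] then symmetrises [e^(nu s)] into [2 cosh (nu s)]. *)
Lemma integral_expR_kernel_besselK nu r : - 1 < nu -> 0 < r ->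
  (\int[mu]_s (expR (nu * s - expR s - (r / 2) ^+ 2 * expR (- s)))%:E =
   (2 * (r / 2) `^ nu * besselK nu r)%:E)%E.
Proof.
move=> nu1 r0.
have r20 : 0 < r / 2 by rewrite divr_gt0.
set q := (r / 2) ^+ 2.
have q0 : 0 < q by rewrite exprn_gt0.
have cf : continuous (fun s => expR (nu * s - expR s - q * expR (- s))).
  have := @continuous_expR_kernel nu 1 q.
  by under eq_fun do rewrite mul1r.
have fin : (\int[mu]_s (expR (nu * s - expR s - q * expR (- s)))%:E < +oo)%E.
  have nu0 : 0 < nu + 1 by rewrite -ltrBlDr sub0r.
  have cg := @continuous_expR_kernel (nu + 1) 1 0.
  have mg : measurable_fun [set: R] (fun s => expR ((nu + 1) * s - expR s)).
    apply: continuous_measurable_fun; move: cg.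
    by under eq_fun do rewrite mul1r mul0r subr0.
  apply: (@le_lt_trans _ _ (\int[mu]_s (q^-1 * expR ((nu + 1) * s - expR s))%:E)%E).
    apply: ge0_le_integral => //.
    - by apply/measurable_EFinP; exact: continuous_measurable_fun.
    - by apply/measurable_EFinP; exact: measurable_funM.
    move=> s _; rewrite lee_fin.
    (* As [nu] may be negative, [exp (- s - q e^(-s)) <= 1 / q] is used to replace the exponent [nu]
       by [nu + 1 > 0]. *)
    have -> : nu * s - expR s - q * expR (- s) =
        (nu + 1) * s - expR s + (- s - q * expR (- s)) by ring.
    rewrite expRD mulrC ler_wpM2r ?expR_ge0//.
    rewrite -(ler_pM2l q0) divff ?gt_eqF// expRB mulrA.
    rewrite ler_pdivrMr ?expR_gt0// mul1r.
    by rewrite (le_trans _ (expR_ge1Dx _))// lerDr.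
  under eq_integral do rewrite EFinM.
  rewrite ge0_integralZl_EFin//; last 2 first.
    exact/measurable_EFinP.
    by rewrite invr_ge0 ltW.
  by rewrite lte_mul_pinfty ?lee_fin ?invr_ge0 ?(ltW q0)// integral_expR_kernel_lty.
have E s : expR (nu * (s + ln (r / 2)) - expR (s + ln (r / 2))
      - q * expR (- (s + ln (r / 2)))) =
    (r / 2) `^ nu * expR (nu * s - r * cosh s).
  have -> : expR (- (s + ln (r / 2))) = (r / 2)^-1 * expR (- s).
    by rewrite opprD expRD (expRN (ln _)) lnK ?posrE// mulrC.
  have -> : expR (s + ln (r / 2)) = r / 2 * expR s by rewrite expRD lnK ?posrE// mulrC.
  rewrite /powR gt_eqF// -expRD /q /cosh; congr expR.
  by field; rewrite gt_eqF.
have cg : continuous (fun s => expR (nu * s - r * cosh s)).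
  have := @continuous_expR_kernel nu (r / 2) (r / 2).
  by under eq_fun => s do rewrite -addrA -opprD -mulrDr -mulrA [2^-1 * _]mulrC.
have coshN s : cosh (- s) = cosh s by rewrite /cosh opprK addrC.
move: fin; rewrite (@ge0_integral_shift _ _ (ln (r / 2)))//.
under eq_integral do rewrite E EFinM.
rewrite ge0_integralZl_EFin ?powR_ge0//; last first.
  by apply/measurable_EFinP; exact: continuous_measurable_fun.
rewrite ge0_integral_fold// -ge0_integralD//; last 2 first.
  by apply/measurable_EFinP; apply: measurable_funTS; exact: continuous_measurable_fun.
  apply/measurable_EFinP; apply: measurable_funTS; apply: continuous_measurable_fun.
  by move=> s; apply: continuous_comp (cg _); exact: (@continuousN _ R^o).
have E2 s : ((expR (nu * s - r * cosh s))%:E + (expR (nu * - s - r * cosh (- s)))%:E =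
    2%:E * (expR (- (r * cosh s)) * cosh (nu * s))%:E)%E.
  rewrite coshN -EFinD -EFinM !expRD mulrN /cosh; congr _%:E.
  by field.
under eq_integral do rewrite E2.
have cosh0 s : 0 <= cosh s by rewrite divr_ge0 ?addr_ge0 ?expR_ge0.
have K0 s : (0 <= (expR (- (r * cosh s)) * cosh (nu * s))%:E)%E.
  by rewrite lee_fin mulr_ge0 ?expR_ge0.
have mcosh : measurable_fun [set: R] (@cosh R).
  apply: measurable_funM => //; apply: measurable_funD => //.
  exact: measurableT_comp.
rewrite ge0_integralZl_EFin//; last first.
  apply/measurable_EFinP; apply: measurable_funTS; apply: measurable_funM.
    apply: measurableT_comp => //; apply: measurableT_comp => //.
    exact: measurable_funM.
  by apply: measurableT_comp => //; exact: measurable_funM.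
rewrite muleA -EFinM [(_ * 2)%R]mulrC.
rewrite /besselK /Rintegral.
set I := (integral _ _ _).
have I0 : (0 <= I)%E by exact: integral_ge0.
have c0 : 0 < 2 * (r / 2) `^ nu by rewrite mulr_gt0// powR_gt0.
(* Finiteness, carried along in the goal, excludes [+oo], for which [fine] would return 0. *)
case: I I0 => [i _ _| |]//=.
by rewrite mulry gtr0_sg// mul1e.
Qed.

End BesselKernel.

(** * Gaussian moments *)

Section GaussianMoments.
Context {R : realType}.
Implicit Types (a b c x s : R).
Notation mu := (@lebesgue_measure R).

Lemma expR_ge_pow_fact i x : 0 <= x -> x ^+ i <= i`!%:R * expR x.
Proof.
move=> x0; rewrite mulrC -ler_pdivrMr ?ltr0n ?fact_gt0//.
case: i => [|i]; first by rewrite expr0 fact0 divr1 -expR0 ler_expR.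
by rewrite (le_trans _ (expR_ge1Dxn i x0))// lerDr.
Qed.

Lemma expR_norm_le x : expR `|x| <= expR x + expR (- x).
Proof.
by have [x0|x0] := ger0P x; [rewrite lerDl expR_ge0|rewrite lerDr expR_ge0].
Qed.

(** Completing the square exhibits a multiple of the normal density of mean [c / (2 b)] and variance
    [1 / (2 b)]. *)
Lemma integral_gauss b c : 0 < b ->
  (\int[mu]_x (expR (c * x - b * x ^+ 2))%:E =
   (Num.sqrt (pi / b) * expR (c ^+ 2 / (4 * b)))%:E)%E.
Proof.
move=> b0; set m := c / (2 * b); set s := Num.sqrt (2 * b)^-1.
have s2 : s ^+ 2 = (2 * b)^-1 by rewrite sqr_sqrtr// invr_ge0 mulr_ge0// ltW.
have s0 : s != 0 by rewrite gt_eqF// sqrtr_gt0 invr_gt0 mulr_gt0.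
have pk : normal_peak s = (Num.sqrt (pi / b))^-1.
  rewrite /normal_peak s2; congr (Num.sqrt _)^-1.
  by field; rewrite gt_eqF.
have P0 : 0 < Num.sqrt (pi / b) by rewrite sqrtr_gt0 divr_gt0 ?pi_gt0.
have E x : (expR (c * x - b * x ^+ 2))%:E =
    ((Num.sqrt (pi / b) * expR (c ^+ 2 / (4 * b)))%:E * (normal_pdf m s x)%:E)%E.
  rewrite normal_pdfE// pk /normal_fun s2 -EFinM mulrACA divff ?gt_eqF// mul1r.
  rewrite -expRD; congr (expR _)%:E; rewrite /m.
  by field; rewrite gt_eqF.
under eq_integral do rewrite E.
rewrite integralZl//; last exact: integrable_normal_pdf.
by rewrite integral_normal_pdf mule1.
Qed.

Lemma continuous_gauss b c : continuous (fun x => expR (c * x - b * x ^+ 2)).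
Proof.
move=> x; apply: continuous_comp; last exact: continuous_expR.
apply: (@continuousB _ R^o).
  by apply: (@continuousM _ R^o); [exact: cst_continuous|exact: cvg_id].
apply: (@continuousM _ R^o); first exact: cst_continuous.
exact: exprn_continuous.
Qed.

Lemma measurable_gauss b c :
  measurable_fun [set: R] (fun x => expR (c * x - b * x ^+ 2)).
Proof. by apply: continuous_measurable_fun; exact: continuous_gauss. Qed.

Lemma integrable_gauss b c : 0 < b ->
  mu.-integrable setT (fun x => (expR (c * x - b * x ^+ 2))%:E).
Proof.
move=> b0; apply/integrableP; split; first by apply/measurable_EFinP; exact: measurable_gauss.
under eq_integral do rewrite gee0_abs ?lee_fin ?expR_ge0//.
by rewrite integral_gauss// ltry.
Qed.

(** The bound [|x|^i <= i! (e^x + e^(-x))] absorbs the power into two Gaussians with linear terms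
    [c + 1] and [c - 1]. *)
Lemma integrable_gauss_pow b c i : 0 < b ->
  mu.-integrable setT (fun x => (x ^+ i * expR (c * x - b * x ^+ 2))%:E).
Proof.
move=> b0.
have intg := integrableD measurableT (integrable_gauss (c + 1) b0)
  (integrable_gauss (c - 1) b0).
apply: le_integrable (integrableZl measurableT (i`!%:R) intg) => //.
- by apply/measurable_EFinP; apply: measurable_funM => //; exact: measurable_gauss.
- move=> x _; rewrite /= lee_fin [leRHS]ger0_norm; last first.
    by rewrite mulr_ge0 ?ler0n ?addr_ge0 ?expR_ge0.
  rewrite normrM [`|expR _|]ger0_norm ?expR_ge0// normrX.
  apply: (@le_trans _ _ (i`!%:R * expR `|x| * expR (c * x - b * x ^+ 2))).
    by rewrite ler_wpM2r ?expR_ge0// expR_ge_pow_fact.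
  rewrite -mulrA ler_wpM2l ?ler0n//.
  apply: (le_trans (ler_wpM2r (expR_ge0 _) (expR_norm_le x))).
  rewrite mulrDl -!expRD; apply: lerD; rewrite ler_expR le_eqVlt;
    by apply/orP; left; apply/eqP; ring.
Qed.

(** The fundamental theorem of calculus on [[-n, n]], with [|f|] dominating the truncations. Only
    the difference of the two boundary values has to vanish in the limit. *)
Lemma integral_derive_eq0 (F f : R -> R) :
  (forall x : R, is_derive x (1 : R) F (f x)) -> continuous f ->
  mu.-integrable setT (EFin \o f) ->
  F n%:R - F (- n%:R) @[n --> \oo] --> 0 ->
  \int[mu]_x f x = 0.
Proof.
move=> dF cf intf F0.
have mf : measurable_fun [set: R] f by exact: continuous_measurable_fun.
have cF x : {for x, continuous F}.
  by apply/differentiable_continuous/derivable1_diffP; have [] := dF x.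
(* The index [n.+1] keeps the interval nondegenerate, as the fundamental theorem requires. *)
have E n : (\int[mu]_x (f \_ `[(- n.+1%:R)%R, n.+1%:R] x)%:E =
    (F n.+1%:R - F (- n.+1%:R))%:E)%E.
  transitivity (\int[mu]_(x in `[(- n.+1%:R)%R, n.+1%:R]) (f x)%:E)%E.
    rewrite [RHS]integral_mkcond; apply: eq_integral => x _.
    by rewrite !patchE; case: ifP.
  rewrite (@continuous_FTC2 _ f F)//.
  - by rewrite (@lt_trans _ _ 0)// ?oppr_lt0 ltr0n.
  - exact: continuous_subspaceT.
  - split; first by move=> x _; have [] := dF x.
      by apply: cvg_at_right_filter; exact: cF.
    by apply: cvg_at_left_filter; exact: cF.
  - by move=> x _; rewrite derive1E; have [_ ->] := dF x.
have [] := @dominated_convergence _ _ _ mu setT measurableT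
  (fun n => EFin \o (f \_ `[(- n.+1%:R)%R, n.+1%:R])) (EFin \o f) (abse \o (EFin \o f)).
- move=> n; apply/measurable_EFinP; apply/measurable_restrict => //.
  exact: measurable_funTS.
- exact/measurable_EFinP.
- apply: aeW => x _; apply: cvg_near_cst; near=> n.
  rewrite /= patchE mem_set//= in_itv/= -ler_norml.
  near: n; exists (Num.truncn `|x|) => // n /= hn.
  by rewrite ltW// (lt_le_trans (truncnS_gt _))// ler_nat ltnS.
- exact: integrable_abse.
- apply: aeW => x n _ /=; rewrite lee_fin patchE; case: ifP => //.
  by rewrite normr0.
move=> _ _ h; rewrite /Rintegral.
have h0 : (F n.+1%:R - F (- n.+1%:R))%:E @[n --> \oo] --> 0%:E.
  apply: cvg_EFin; first by near=> n.
  by have := F0; rewrite -(cvg_shiftS (fun n => F n%:R - F (- n%:R))).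
have hE : (fun n => (F n.+1%:R - F (- n.+1%:R))%:E) =
    (fun n => \int[mu]_x (EFin \o (f \_ `[(- n.+1%:R)%R, n.+1%:R])) x)%E.
  by apply/funext => n; rewrite /= -E.
by rewrite hE in h0; rewrite (cvg_unique _ h h0).
Unshelve. all: by end_near. Qed.

End GaussianMoments.

(** * Algebra of moments against powers of [x - J y] *)

Section MomentAlgebra.
Context {K : comNzRingType}.
Variables (a b J : K) (L : nat -> nat -> K).

(* Encodes the integral of x^p y^q (x - J y)^k when [L p q] is that of x^p y^q. *)
Fixpoint antiholo_moment k p q : K :=
  if k is k'.+1 then antiholo_moment k' p.+1 q - J * antiholo_moment k' p q.+1
  else L p q.

Hypothesis Lp : forall p q, b * L p.+1 q = a * L p q + p%:R * L p.-1 q.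
Hypothesis Lq : forall p q, b * L p q.+1 = q%:R * L p q.-1.

(** Integration by parts in [x] for the extended moments: the last term is the derivative of
    [(x - J y)^k]. At [p = 0] or [k = 0] the truncated predecessor is harmless, its coefficient
    being 0. *)
Let Mp k p q : b * antiholo_moment k p.+1 q =
  a * antiholo_moment k p q + p%:R * antiholo_moment k p.-1 q
    + k%:R * antiholo_moment k.-1 p q.
Proof.
elim: k p q => [|k IH] p q; first by rewrite /= Lp mul0r addr0.
rewrite [LHS]/= mulrBr mulrCA !IH /=.
case: k IH => [|k] IH; case: p => [|p] /=; rewrite -?[in X in X%:R]natr1 ?mul0r;
  rewrite -?natr1; ring.
Qed.

(** The same in [y], where [(x - J y)^k] contributes [- J k (x - J y)^(k - 1)]. *)
Let Mq k p q : b * antiholo_moment k p q.+1 =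
  q%:R * antiholo_moment k p q.-1 - J * (k%:R * antiholo_moment k.-1 p q).
Proof.
elim: k p q => [|k IH] p q; first by rewrite /= Lq mul0r mulr0 subr0.
rewrite [LHS]/= mulrBr mulrCA !IH /=.
case: k IH => [|k] IH; case: q => [|q] /=; rewrite -?natr1; ring.
Qed.

(** Subtracting [J] times the [y] rule from the [x] rule leaves [(1 + J^2) k] in front of the moment
    of order [k - 1]. With [J^2 = -1] this is the Cauchy-Riemann cancellation, and a one-step
    geometric recursion remains. *)
Lemma antiholo_moment_exp k : J * J = -1 ->
  b ^+ k * antiholo_moment k 0 0 = a ^+ k * L 0 0.
Proof.
move=> J2; elim: k => [|k IH]; first by rewrite !expr0.
have H : b * antiholo_moment k.+1 0 0 = a * antiholo_moment k 0 0.
  rewrite /= mulrBr mulrCA Mp Mq /=.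
  transitivity (a * antiholo_moment k 0 0 +
    (1 + J * J) * (k%:R * antiholo_moment k.-1 0 0)); first by ring.
  by rewrite J2 subrr mul0r addr0.
by rewrite exprSr -mulrA H mulrCA IH exprS mulrA.
Qed.

End MomentAlgebra.

Section GaussianPlane.
Context {R : realType}.
Implicit Types (a b c x s : R).
Notation mu := (@lebesgue_measure R).

Definition gauss_moment b c i : R :=
  \int[mu]_x (x ^+ i * expR (c * x - b * x ^+ 2)).

Lemma eq_is_derive (f g : R -> R) x df dg : is_derive x (1 : R) f df ->
  f =1 g -> df = dg -> is_derive x (1 : R) g dg.
Proof. by move=> H /funext <- <-. Qed.

Lemma gauss_moment0 b c : 0 < b ->
  gauss_moment b c 0 = Num.sqrt (pi / b) * expR (c ^+ 2 / (4 * b)).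
Proof.
move=> b0; rewrite /gauss_moment /Rintegral.
by under eq_integral do rewrite expr0 mul1r; rewrite integral_gauss.
Qed.

Lemma is_derive_gauss_pow b c i x : is_derive x (1 : R)
  (fun x => x ^+ i * expR (c * x - b * x ^+ 2))
  ((i%:R * x ^+ i.-1 + c * x ^+ i - 2 * b * x ^+ i.+1) * expR (c * x - b * x ^+ 2)).
Proof.
have d1 : is_derive x (1 : R) (fun x : R => x ^+ i) (i%:R * x ^+ i.-1).
  have := @is_deriveX _ _ (@id R) i x 1 1 (is_derive_id _ _).
  by rewrite [(_ *: _)%R]mulr1 exprfctE.
have d2 : is_derive x (1 : R) (fun x : R => c * x - b * x ^+ 2) (c - 2 * b * x).
  have dx2 : is_derive x (1 : R) (fun x : R => x ^+ 2) (2 * x).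
    have := @is_deriveX _ _ (@id R) 2 x 1 1 (is_derive_id _ _).
    by rewrite [(_ *: _)%R]mulr1 exprfctE expr1.
  apply: (eq_is_derive (is_deriveB (is_deriveZ c (is_derive_id x (1 : R)))
    (is_deriveZ b dx2))) => //.
  by rewrite /GRing.scale/=; ring.
apply: (eq_is_derive (is_deriveM d1 (is_derive1_comp (is_derive_expR _) d2))) => //.
by rewrite /GRing.scale/= [x ^+ i.+1]exprS; ring.
Qed.

Lemma gauss_pow_cvg0 b c i : 0 < b ->
  (n%:R ^+ i * expR (c * n%:R - b * n%:R ^+ 2)) @[n --> \oo] --> (0 : R).
Proof.
(* One unit of [c + 2] absorbs [n^i <= i! e^n], the other leaves the factor [e^(-n)]; the constant
   exponent is the maximum of [(c + 2) x - b x^2]. *)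
move=> b0; pose C := i`!%:R * expR ((c + 2) ^+ 2 / (4 * b)).
apply: (@squeeze_cvgr _ _ _ _ (cst 0) (fun n => C * expR (- n%:R))).
- apply: nearW => n; rewrite mulr_ge0 ?exprn_ge0 ?expR_ge0//=.
  apply: (le_trans (ler_wpM2r (expR_ge0 _) (expR_ge_pow_fact i (ler0n _ n)))).
  rewrite /C -!mulrA ler_wpM2l// -!expRD ler_expR -subr_ge0.
  rewrite (_ : _ - _ = (c + 2 - 2 * b * n%:R) ^+ 2 / (4 * b)).
    by rewrite divr_ge0 ?sqr_ge0// mulr_ge0// ltW.
  by field; rewrite gt_eqF.
- exact: cvg_cst.
- by rewrite -[0](mulr0 C); apply: cvgM; [exact: cvg_cst|exact: cvgn_expR].
Qed.

(** The derivative of [x^i exp (c x - b x^2)] has integral 0. *)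
Lemma gauss_moment_rec b c i : 0 < b ->
  2 * b * gauss_moment b c i.+1 =
  c * gauss_moment b c i + i%:R * gauss_moment b c i.-1.
Proof.
move=> b0.
pose g j x := x ^+ j * expR (c * x - b * x ^+ 2).
have ig j : mu.-integrable setT (EFin \o g j) by exact: integrable_gauss_pow.
pose f x := (i%:R * x ^+ i.-1 + c * x ^+ i - 2 * b * x ^+ i.+1)
   * expR (c * x - b * x ^+ 2).
have iZ k j : mu.-integrable setT (EFin \o (fun x => k * g j x)).
  by have := integrableZl measurableT k (ig j).
have iD : mu.-integrable setT (EFin \o (fun x => i%:R * g i.-1 x + c * g i x)).
  by have := integrableD measurableT (iZ i%:R i.-1) (iZ c i).
have fE : f = fun x => i%:R * g i.-1 x + c * g i x - 2 * b * g i.+1 x.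
  by apply/funext => x; rewrite /f /g; ring.
have If : \int[mu]_x f x = 0.
  apply: (@integral_derive_eq0 _ (g i)) => //.
  - by move=> x; exact: is_derive_gauss_pow.
  - move=> x; have : {for x, continuous f}; last by [].
    apply: (@continuousM _ R^o); last exact: continuous_gauss.
    apply: (@continuousB _ R^o); first apply: (@continuousD _ R^o).
    + by apply: (@continuousM _ R^o); [exact: cst_continuous|exact: exprn_continuous].
    + by apply: (@continuousM _ R^o); [exact: cst_continuous|exact: exprn_continuous].
    + by apply: (@continuousM _ R^o); [exact: cst_continuous|exact: exprn_continuous].
  - rewrite fE; have := integrableB measurableT iD (iZ (2 * b) i.+1).
    by [].
  - have h1 := gauss_pow_cvg0 c i b0.
    have h2 := gauss_pow_cvg0 (- c) i b0.
    rewrite -[0](subr0 0) -{2}(mulr0 ((-1) ^+ i)).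
    apply: cvgB => //.
    (* At [- n] the boundary term is [(-1)^i] times the one at [n] with [- c] in place of [c]. *)
    under eq_fun do rewrite /g exprNn sqrrN mulrN -mulNr -mulrA.
    by apply: cvgM => //; exact: cvg_cst.
move: If; rewrite fE RintegralB// RintegralD// !RintegralZl//.
rewrite /gauss_moment -/(g i) -/(g i.+1) -/(g i.-1) => /eqP.
by rewrite subr_eq0 => /eqP <-; rewrite addrC.
Qed.

End GaussianPlane.

(** * Real parts and moduli of complex numbers *)

Section ComplexBasics.
Context {R : realType}.
Implicit Types (w v : R[i]) (c : R).

Lemma Re_mul_real w c : complex.Re (w * c%:C) = complex.Re w * c.
Proof. by case: w => a b /=; rewrite mulr0 subr0. Qed.

Lemma Re_add w v : complex.Re (w + v) = complex.Re w + complex.Re v.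
Proof. by case: w v => [? ?] [? ?]. Qed.

Lemma cmod_normc w : cmod w = ComplexField.Normc.normc w.
Proof. by case: w. Qed.

Lemma cmodM w v : cmod (w * v) = cmod w * cmod v.
Proof. by rewrite !cmod_normc ComplexField.Normc.normcM. Qed.

Lemma cmod_ge0 w : 0 <= cmod w.
Proof. exact: sqrtr_ge0. Qed.

Lemma cmod1 : cmod (1 : R[i]) = 1.
Proof. by rewrite cmod_normc ComplexField.Normc.normc1. Qed.

Lemma cmodX w n : cmod (w ^+ n) = cmod w ^+ n.
Proof.
by elim: n => [|n IH]; rewrite ?cmod1// !exprS cmodM IH.
Qed.

Lemma normr_Re_le w : `|complex.Re w| <= cmod w.
Proof.
by rewrite -sqrtr_sqr ler_wsqrtr// lerDl sqr_ge0.
Qed.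

Lemma cmod_le_norm1 (x y : R) : cmod (x +i* y) <= `|x| + `|y|.
Proof.
rewrite -[leRHS]ger0_norm ?addr_ge0// -sqrtr_sqr ler_wsqrtr//= sqrrD.
rewrite -(real_normK (num_real x)) -(real_normK (num_real y)) addrAC lerDl.
by rewrite mulrn_wge0// mulr_ge0.
Qed.

End ComplexBasics.

(** * Integrals of products of one-variable functions *)

Section ProductIntegral.
Context {R : realType}.
Implicit Types (f g : R -> R).
Notation mu := (@lebesgue_measure R).

Lemma integrable_prod_mul f g :
  mu.-integrable setT (EFin \o f) -> mu.-integrable setT (EFin \o g) ->
  (mu \x mu)%E.-integrable setT (fun p => (f p.1 * g p.2)%:E).
Proof.
move=> intf intg.
have mf : measurable_fun [set: R] f by apply/measurable_EFinP; exact: measurable_int intf.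
have mg : measurable_fun [set: R] g by apply/measurable_EFinP; exact: measurable_int intg.
apply/integrable12ltyP.
  apply/measurable_EFinP; apply: measurable_funM.
    by apply: measurableT_comp => //; exact: measurable_fst.
  by apply: measurableT_comp => //; exact: measurable_snd.
have ng : (\int[mu]_y `|(g y)%:E| \is a fin_num)%E.
  by apply: integral_fune_fin_num => //; exact: integrable_abse.
have nf : (\int[mu]_x `|(f x)%:E| \is a fin_num)%E.
  by apply: integral_fune_fin_num => //; exact: integrable_abse.
under eq_integral => x _.
  under eq_integral do rewrite /= normrM EFinM.
  rewrite ge0_integralZl_EFin//; last first.
    by apply/measurable_EFinP; exact: measurableT_comp.
  over.
rewrite -(fineK ng) ge0_integralZr//.
- by rewrite -(fineK nf) -EFinM ltry.
- by apply/measurable_EFinP; exact: measurableT_comp.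
- by rewrite ?lee_fin; do ?apply: fine_ge0; exact: integral_ge0.
Qed.

Lemma Rintegral_prod_mul f g :
  mu.-integrable setT (EFin \o f) -> mu.-integrable setT (EFin \o g) ->
  \int[(mu \x mu)%E]_p (f p.1 * g p.2) = (\int[mu]_x f x) * (\int[mu]_y g y).
Proof.
move=> intf intg.
have int := integrable_prod_mul intf intg.
have ng : (\int[mu]_y (g y)%:E \is a fin_num)%E by exact: integral_fune_fin_num.
have nf : (\int[mu]_x (f x)%:E \is a fin_num)%E by exact: integral_fune_fin_num.
rewrite {1}/Rintegral -integral12_prod_meas1//.
under eq_integral => x _.
  rewrite /fubini_F; under eq_integral do rewrite /= EFinM.
  rewrite integralZl//=; over.
by rewrite -(fineK ng) integralZr// fineM.
Qed.

End ProductIntegral.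

(** * Planar Gaussian moments of powers of the conjugate *)

Section GaussianPlaneMoment.
Context {R : realType}.
Implicit Types (b c : R) (w : R[i]) (u : R * R).
Notation mu := (@lebesgue_measure R).

(** The null linear term in [u.2] gives both factors the shape of the one-dimensional Gaussians, so
    the same moment lemmas serve for each. *)
Definition gauss_plane b c u : R :=
  expR (c * u.1 - b * u.1 ^+ 2) * expR (0 * u.2 - b * u.2 ^+ 2).

Definition plane_moment b c p q : R[i] :=
  (gauss_moment b c p * gauss_moment b 0 q)%:C.

(** Splitting off one factor [u.1 - i u.2] raises [p], or raises [q] and multiplies [w] by [- i];
    hence the induction on [k] for all [w], [p], [q]. *)
Lemma gauss_plane_antiholo b c w k p q : 0 < b ->
  (mu \x mu)%E.-integrable setT (fun u => (complex.Re (w * (u.1 -i* u.2) ^+ k)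
    * (u.1 ^+ p * u.2 ^+ q * gauss_plane b c u))%:E) /\
  \int[(mu \x mu)%E]_u (complex.Re (w * (u.1 -i* u.2) ^+ k)
    * (u.1 ^+ p * u.2 ^+ q * gauss_plane b c u)) =
  complex.Re (w * antiholo_moment 'i%C (plane_moment b c) k p q).
Proof.
move=> b0; elim: k w p q => [|k IH] w p q.
  have E : (fun u : R * R => complex.Re (w * (u.1 -i* u.2) ^+ 0)
      * (u.1 ^+ p * u.2 ^+ q * gauss_plane b c u)) =
    (fun u => (complex.Re w * (u.1 ^+ p * expR (c * u.1 - b * u.1 ^+ 2)))
      * (u.2 ^+ q * expR (0 * u.2 - b * u.2 ^+ 2))).
    by apply/funext => u; rewrite expr0 mulr1 /gauss_plane; ring.
  have i1 : mu.-integrable setT (EFin \o (fun x => complex.Re w *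
      (x ^+ p * expR (c * x - b * x ^+ 2)))).
    by have := integrableZl measurableT (complex.Re w) (integrable_gauss_pow c p b0).
  have i2 := integrable_gauss_pow 0 q b0.
  split.
    apply: eq_integrable (integrable_prod_mul i1 i2) => // u _ /=; congr (_%:E).
    exact: esym (congr1 (fun f => f u) E).
  rewrite E (Rintegral_prod_mul i1 i2) RintegralZl//; last exact: integrable_gauss_pow.
  by rewrite /= Re_mul_real mulrA.
have [i1 e1] := IH w p.+1 q; have [i2 e2] := IH (w * - 'i%C) p q.+1.
have E : (fun u : R * R => complex.Re (w * (u.1 -i* u.2) ^+ k.+1)
      * (u.1 ^+ p * u.2 ^+ q * gauss_plane b c u)) =
    (fun u => complex.Re (w * (u.1 -i* u.2) ^+ k)
        * (u.1 ^+ p.+1 * u.2 ^+ q * gauss_plane b c u)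
      + complex.Re (w * - 'i%C * (u.1 -i* u.2) ^+ k)
        * (u.1 ^+ p * u.2 ^+ q.+1 * gauss_plane b c u)).
  apply/funext => u.
  have -> : w * (u.1 -i* u.2) ^+ k.+1 = w * (u.1 -i* u.2) ^+ k * u.1%:C
      + w * - 'i%C * (u.1 -i* u.2) ^+ k * u.2%:C.
    rewrite exprSr mulrA; set v := _ ^+ k.
    have -> : u.1 -i* u.2 = u.1%:C - 'i%C * u.2%:C by simpc.
    by ring.
  by rewrite Re_add !Re_mul_real !exprS; ring.
split.
  apply: eq_integrable (integrableD measurableT i1 i2) => // u _ /=; congr (_%:E).
  exact: esym (congr1 (fun f => f u) E).
rewrite E RintegralD// e1 e2 -Re_add; congr complex.Re => /=.
by ring.
Qed.

Lemma integral_gauss_plane_antiholo b c w k : 0 < b ->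
  (mu \x mu)%E.-integrable setT (fun u =>
    (complex.Re (w * (u.1 -i* u.2) ^+ k) * gauss_plane b c u)%:E) /\
  \int[(mu \x mu)%E]_u (complex.Re (w * (u.1 -i* u.2) ^+ k) * gauss_plane b c u) =
  complex.Re (w * (c / (2 * b))%:C ^+ k) * (pi / b * expR (c ^+ 2 / (4 * b))).
Proof.
move=> b0; have := gauss_plane_antiholo c w k 0 0 b0.
under eq_fun do rewrite !expr0 !mul1r.
under eq_Rintegral do rewrite !expr0 !mul1r.
move=> [i ->]; split => //.
rewrite -Re_mul_real -mulrA; congr (complex.Re (w * _)).
have b20 : (2 * b)%:C != 0 :> R[i].
  by rewrite (inj_eq (@complexI R)) gt_eqF// mulr_gt0.
apply: (mulfI (expf_neq0 k b20)).
rewrite (@antiholo_moment_exp _ c%:C).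
- rewrite mulrA -exprMn -rmorphM/=; congr (_%:C ^+ k * _).
    by rewrite mulrC divfK// gt_eqF// mulr_gt0.
  rewrite /plane_moment; congr (_%:C).
  rewrite !gauss_moment0// expr0n/= mul0r expR0 mulr1 mulrAC -expr2 sqr_sqrtr//.
  by rewrite divr_ge0 ?pi_ge0// ltW.
- move=> p q; rewrite /plane_moment -!rmorphM/= -(rmorph_nat (real_complex R)).
  rewrite -rmorphM -rmorphD/=; congr (_%:C).
  by rewrite mulrA gauss_moment_rec// mulrDl !mulrA.
- move=> p q; rewrite /plane_moment -!rmorphM/= -(rmorph_nat (real_complex R)).
  rewrite -rmorphM/=; congr (_%:C).
  by rewrite mulrCA gauss_moment_rec// mul0r add0r mulrCA.
- by rewrite -expr2 sqr_i.
Qed.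

End GaussianPlaneMoment.

(** * The complex exponential series *)

Section ComplexExponential.
Context {R : realType}.
Implicit Types (e w : R[i]) (t : R).

(** This is [Re (e exp (t w))]. The real parameter [t] reduces the complex Taylor expansion to
    calculus in one real variable, differentiation being the replacement of [e] by [e * w]. *)
Definition Re_cexp e w t : R :=
  expR (t * complex.Re w) *
    (complex.Re e * cos (t * complex.Im w) - complex.Im e * sin (t * complex.Im w)).

Definition Re_cexp_sum e w n t : R :=
  \sum_(k < n) complex.Re (e * w ^+ k) * (t ^+ k / k`!%:R).

Lemma is_derive_Re_cexp e w t :
  is_derive t (1 : R) (Re_cexp e w) (Re_cexp (e * w) w t).
Proof.
have dl c : is_derive t (1 : R) (fun s => s * c) c.
  apply: (eq_is_derive (is_deriveZ c (is_derive_id t (1 : R)))) => [s|].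
    by rewrite /GRing.scale/= mulrC.
  by rewrite [(_ *: _)%R]mulr1.
have dE := @is_derive1_comp _ expR (fun s => s * complex.Re w) t _ _
  (is_derive_expR _) (dl (complex.Re w)).
have dC := @is_derive1_comp _ cos (fun s => s * complex.Im w) t _ _
  (is_derive_cos _) (dl (complex.Im w)).
have dS := @is_derive1_comp _ sin (fun s => s * complex.Im w) t _ _
  (is_derive_sin _) (dl (complex.Im w)).
have dT : is_derive t (1 : R) (fun s => complex.Re e * cos (s * complex.Im w)
    - complex.Im e * sin (s * complex.Im w))
    (complex.Re e * (- sin (t * complex.Im w) * complex.Im w)
     - complex.Im e * (cos (t * complex.Im w) * complex.Im w)).
  exact: (eq_is_derive (is_deriveB (is_deriveZ (complex.Re e) dC)
    (is_deriveZ (complex.Im e) dS))).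
apply: (eq_is_derive (is_deriveM dE dT)) => //.
rewrite /Re_cexp /GRing.scale/=; case: e {dT} => e1 e2; case: w {dl dE dC dS} => p q /=.
by ring.
Qed.

Lemma is_derive_Re_cexp_sum e w n t :
  is_derive t (1 : R) (Re_cexp_sum e w n.+1) (Re_cexp_sum (e * w) w n t).
Proof.
have dX k : is_derive t (1 : R) (fun s : R => s ^+ k.+1 / k.+1`!%:R) (t ^+ k / k`!%:R).
  have dX := @is_deriveX _ _ (@id R) k.+1 t 1 1 (is_derive_id _ _).
  apply: (eq_is_derive (is_deriveZ (k.+1`!%:R)^-1 dX)) => [s|].
    by rewrite exprfctE /GRing.scale/= mulrC.
  rewrite [(_ *: 1)%R]mulr1 /GRing.scale/= factS natrM.
  by field; rewrite pnatr_eq0 -lt0n fact_gt0 addrC natr1 pnatr_eq0.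
elim: n => [|n IH].
  apply: (eq_is_derive (is_derive_cst (complex.Re e) t (1 : R))) => [s|].
    by rewrite /Re_cexp_sum big_ord1 !expr0 mulr1 fact0 divr1 mulr1.
  by rewrite /Re_cexp_sum big_ord0.
apply: (eq_is_derive (is_deriveD IH (is_deriveZ (complex.Re (e * w ^+ n.+1)) (dX n)))).
  by move=> s; rewrite /Re_cexp_sum [RHS]big_ord_recr.
by rewrite /Re_cexp_sum [RHS]big_ord_recr/= -mulrA -[w * _]exprS.
Qed.

(** Both [B t^(n + 1) / (n + 1)! + D] and [B t^(n + 1) / (n + 1)! - D] vanish at 0 and have
    nonnegative derivative on [[0, 1]]; the mean value theorem makes them nonnegative. *)
Lemma normr_le_pow_fact (D d : R -> R) (B : R) n :
  (forall s, is_derive s (1 : R) D (d s)) -> D 0 = 0 ->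
  (forall s, 0 <= s -> s <= 1 -> `|d s| <= B * (s ^+ n / n`!%:R)) ->
  forall t, 0 <= t -> t <= 1 -> `|D t| <= B * (t ^+ n.+1 / n.+1`!%:R).
Proof.
move=> dD D0 db t t0 t1.
have dX s : is_derive s (1 : R) (fun s : R => B * (s ^+ n.+1 / n.+1`!%:R))
    (B * (s ^+ n / n`!%:R)).
  have dX := @is_deriveX _ _ (@id R) n.+1 s 1 1 (is_derive_id _ _).
  apply: (eq_is_derive (is_deriveZ (B / n.+1`!%:R) dX)) => [u|].
    by rewrite exprfctE -[LHS]/(B / n.+1`!%:R * u ^+ n.+1) -mulrA [_^-1 * _]mulrC.
  rewrite [(_ *: 1)%R]mulr1 /GRing.scale/= factS natrM.
  by field; rewrite pnatr_eq0 -lt0n fact_gt0 addrC natr1 pnatr_eq0.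
have key (h dh : R -> R) : (forall s, is_derive s (1 : R) h (dh s)) -> h 0 = 0 ->
    (forall s, 0 <= s -> s <= 1 -> 0 <= dh s) -> 0 <= h t.
  move=> dh1 h0 dh0.
  have [c] := @MVT_segment _ h dh 0 t t0 (fun x _ => dh1 x) (derivable_within_continuous
    (fun x _ => @ex_derive _ _ _ _ _ _ _ (dh1 x))).
  rewrite in_itv/= => /andP[c0 ct]; rewrite h0 subr0 => ->.
  by rewrite mulr_ge0 ?subr0// dh0// (le_trans ct).
rewrite ler_norml; apply/andP; split.
- rewrite lerNl -subr_ge0 opprK.
  have dh s : is_derive s (1 : R) (fun s => B * (s ^+ n.+1 / n.+1`!%:R) + D s)
      (B * (s ^+ n / n`!%:R) + d s) by exact: is_deriveD (dX s) (dD s).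
  apply: (key _ _ dh).
    by rewrite D0 addr0 expr0n/= mul0r mulr0.
  by move=> s s0 s1; rewrite addrC -lerBlDr sub0r; have := db s s0 s1;
    rewrite ler_norml => /andP[].
- rewrite -subr_ge0.
  have dh s : is_derive s (1 : R) (fun s => B * (s ^+ n.+1 / n.+1`!%:R) - D s)
      (B * (s ^+ n / n`!%:R) - d s) by exact: is_deriveB (dX s) (dD s).
  apply: (key _ _ dh).
    by rewrite D0 subr0 expr0n/= mul0r mulr0.
  by move=> s s0 s1; rewrite subr_ge0; have := db s s0 s1;
    rewrite ler_norml => /andP[].
Qed.

Lemma Re_cexpE e w : complex.Re (e * cexp w) = Re_cexp e w 1.
Proof.
rewrite /Re_cexp /cexp !mul1r; case: e => a b; case: w => p q /=; ring.
Qed.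

(** Taylor remainder by induction on [n]: the derivative of the error of order [n + 1] for [e] is
    the error of order [n] for [e * w], and [cmod] is multiplicative. *)
Lemma Re_cexp_sum_err e w n t : 0 <= t -> t <= 1 ->
  `|Re_cexp e w t - Re_cexp_sum e w n t| <=
  (cmod e * expR `|complex.Re w| * cmod w ^+ n) * (t ^+ n / n`!%:R).
Proof.
elim: n e t => [|n IH] e t t0 t1.
  rewrite /Re_cexp_sum big_ord0 subr0 expr0 fact0 divr1 !mulr1.
  have -> : Re_cexp e w t = complex.Re (e * (cos (t * complex.Im w) +i* sin (t * complex.Im w)))
      * expR (t * complex.Re w) by rewrite /Re_cexp; case: e => a b /=; ring.
  rewrite normrM [`|expR _|]ger0_norm ?expR_ge0//; apply: ler_pM => //.
    apply: le_trans (normr_Re_le _) _; rewrite cmodM {2}/cmod/= cos2Dsin2.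
    by rewrite sqrtr1 mulr1.
  rewrite ler_expR; apply: le_trans (ler_norm _) _.
  by rewrite normrM ger0_norm// ler_piMl.
have -> : cmod e * expR `|complex.Re w| * cmod w ^+ n.+1 =
    cmod (e * w) * expR `|complex.Re w| * cmod w ^+ n.
  by rewrite cmodM exprS; ring.
have dD s : is_derive s (1 : R) (fun s => Re_cexp e w s - Re_cexp_sum e w n.+1 s)
    (Re_cexp (e * w) w s - Re_cexp_sum (e * w) w n s).
  exact: is_deriveB (is_derive_Re_cexp _ _ _) (is_derive_Re_cexp_sum _ _ _ _).
refine (normr_le_pow_fact dD _ _ t0 t1); last by move=> s s0 s1; exact: IH.
rewrite /Re_cexp /Re_cexp_sum !mul0r expR0 cos0 sin0 mulr0 subr0 mulr1 mul1r.
rewrite big_ord_recl big1 => [|i _]; last by rewrite expr0n/= mul0r mulr0.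
by rewrite !expr0 fact0 divr1 !mulr1 addr0 subrr.
Qed.

Lemma cvg_Re_cexp_sum e w :
  Re_cexp_sum e w n 1 @[n --> \oo] --> complex.Re (e * cexp w).
Proof.
rewrite Re_cexpE -[X in _ --> X]subr0.
have -> : Re_cexp_sum e w ^~ 1 = fun n => Re_cexp e w 1 - (Re_cexp e w 1 - Re_cexp_sum e w n 1).
  by apply/funext => n; rewrite opprB addrC subrK.
apply: cvgB; first exact: cvg_cst.
apply/norm_cvg0P.
apply: (@squeeze_cvgr _ _ _ _ (cst 0)
  (fun n => (cmod e * expR `|complex.Re w|) * exp_coeff (cmod w) n)).
- apply: nearW => n; rewrite normr_ge0/=.
  apply: le_trans (Re_cexp_sum_err e w n ler01 (lexx _)) _.
  by rewrite expr1n /exp_coeff/= mul1r mulrA.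
- exact: cvg_cst.
- rewrite -[X in _ --> X](mulr0 (cmod e * expR `|complex.Re w|)).
  apply: cvgM; first exact: cvg_cst.
  exact: cvg_exp_coeff.
Qed.

End ComplexExponential.

(** * The series of the modified Bessel function *)

Section BesselSeries.
Context {R : realType}.
Implicit Types (e q w : R[i]) (nu m : R).

Lemma limn_complex (v : nat -> R[i]) (a b : R) :
  complex.Re (v n) @[n --> \oo] --> a -> complex.Im (v n) @[n --> \oo] --> b ->
  limn (v : nat -> R[i]^o) = a +i* b.
Proof.
move=> va vb; apply: cvg_lim; first exact: norm_hausdorff.
apply/cvgrPdist_lt => -[e e']; rewrite ltcE/= => /andP[/eqP -> e0].
have e20 : 0 < e / 2 by rewrite divr_gt0.
move/cvgrPdist_lt : va => /(_ _ e20) va; move/cvgrPdist_lt : vb => /(_ _ e20) vb.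
near=> n.
have -> : `|a +i* b - v n| = (cmod (a +i* b - v n))%:C by rewrite cmod_normc.
rewrite ltcR; case E : (v n) => [x y].
have -> : a +i* b - (x +i* y) = (a - x) +i* (b - y) by simpc.
apply: le_lt_trans (cmod_le_norm1 _ _) _.
rewrite (splitr e); apply: ltrD.
- have : `|a - complex.Re (v n)| < e / 2 by near: n.
  by rewrite E.
- have : `|b - complex.Im (v n)| < e / 2 by near: n.
  by rewrite E.
Unshelve. all: by end_near. Qed.

Definition bessel_coef nu k : R := (k`!%:R * Gamma (nu + k%:R + 1))^-1.

Definition bessel_sum nu e q n : R :=
  \sum_(k < n) complex.Re (e * q ^+ k) * bessel_coef nu k.

Lemma bessel_arg_gt0 nu k : - 1 < nu -> 0 < nu + k%:R + 1.
Proof.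
by move=> nu1; rewrite -addrA natr1 -ltrBlDr sub0r (le_lt_trans _ nu1)// lerN2 ler1n.
Qed.

Lemma bessel_coef_ge0 nu k : - 1 < nu -> 0 <= bessel_coef nu k.
Proof.
by move=> nu1; rewrite invr_ge0 mulr_ge0// ltW// Gamma_gt0// bessel_arg_gt0.
Qed.

(* The growth of Gamma lets the geometric rate [expR (- m)] be as small as desired. *)
Lemma bessel_coef_le nu m k : - 1 < nu ->
  bessel_coef nu k <= expR (expR (m + 1) - (nu + 1) * m) * (expR (- m) ^+ k / k`!%:R).
Proof.
move=> nu1; have x0 := bessel_arg_gt0 k nu1.
have k0 : 0 < k`!%:R :> R by rewrite ltr0n fact_gt0.
rewrite /bessel_coef invfM mulrC mulrA ler_wpM2r ?invr_ge0 ?(ltW k0)//.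
rewrite -expRM_natl -expRD.
have -> : expR (m + 1) - (nu + 1) * m + k%:R * - m =
   - ((nu + k%:R + 1) * m - expR (m + 1)) by ring.
by rewrite expRN lef_pV2 ?posrE ?expR_gt0 ?Gamma_gt0// Gamma_ge_expR.
Qed.

Lemma bessel_term_le nu e q m k : - 1 < nu ->
  `|complex.Re (e * q ^+ k) * bessel_coef nu k| <=
  cmod e * expR (expR (m + 1) - (nu + 1) * m) * exp_coeff (expR (- m) * cmod q) k.
Proof.
move=> nu1; rewrite normrM [`|bessel_coef _ _|]ger0_norm ?bessel_coef_ge0//.
apply: (@le_trans _ _ (cmod e * cmod q ^+ k *
    (expR (expR (m + 1) - (nu + 1) * m) * (expR (- m) ^+ k / k`!%:R)))).
  apply: ler_pM => //; [exact: bessel_coef_ge0| |exact: bessel_coef_le].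
  by apply: le_trans (normr_Re_le _) _; rewrite cmodM cmodX.
by rewrite le_eqVlt; apply/orP; left; apply/eqP; rewrite /exp_coeff/= exprMn; ring.
Qed.

Lemma series_exp_coeff_le (x : R) n : 0 <= x -> series (exp_coeff x) n <= expR x.
Proof.
move=> x0; apply: nondecreasing_cvgn_le; last exact: is_cvg_series_exp_coeff.
apply/nondecreasing_seqP => k.
by rewrite /series/= big_nat_recr//= lerDl exp_coeff_ge0.
Qed.

Lemma bessel_sum_le nu e q m n : - 1 < nu ->
  `|bessel_sum nu e q n| <=
  cmod e * expR (expR (m + 1) - (nu + 1) * m) * expR (expR (- m) * cmod q).
Proof.
move=> nu1; set C := cmod e * _.
have C0 : 0 <= C by rewrite mulr_ge0 ?cmod_ge0 ?expR_ge0.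
apply: (@le_trans _ _ (C * series (exp_coeff (expR (- m) * cmod q)) n)); last first.
  by rewrite ler_wpM2l// series_exp_coeff_le// mulr_ge0 ?expR_ge0 ?cmod_ge0.
rewrite /series/= big_mkord mulr_sumr.
apply: le_trans (ler_norm_sum _ _ _) _; apply: ler_sum => k _.
exact: bessel_term_le.
Qed.

Lemma is_cvg_bessel_sum nu e q : - 1 < nu -> cvgn (bessel_sum nu e q).
Proof.
move=> nu1.
have -> : bessel_sum nu e q = series (fun k => complex.Re (e * q ^+ k) * bessel_coef nu k).
  by apply/funext => n; rewrite /bessel_sum /series/= big_mkord.
apply: normed_cvg.
apply: (@series_le_cvg _ _ (fun k => cmod e * expR (expR (0 + 1) - (nu + 1) * 0) *
   exp_coeff (expR (- 0) * cmod q) k)).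
- by move=> k; rewrite /= normr_ge0.
- move=> k; apply: mulr_ge0; first by rewrite mulr_ge0 ?cmod_ge0 ?expR_ge0.
  by apply: exp_coeff_ge0; rewrite mulr_ge0 ?expR_ge0 ?cmod_ge0.
- by move=> k; exact: bessel_term_le.
- exact: (@is_cvg_seriesZ _ _ _ (is_cvg_series_exp_coeff (expR (- 0) * cmod q))).
Qed.

(** The values [e = 1] and [e = - i] give the real and the imaginary part of the complex partial
    sum, so these two real limits determine [besselI_even] and every [Re (e w)]. *)
Lemma bessel_sum_lin nu e q n : bessel_sum nu e q n =
  complex.Re e * bessel_sum nu 1 q n - complex.Im e * bessel_sum nu (- 'i%C) q n.
Proof.
rewrite /bessel_sum !mulr_sumr -sumrB; apply: eq_bigr => k _.
by case: (q ^+ k) => x y; case: e => a b /=; ring.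
Qed.

Lemma cvg_besselI_even nu e w : - 1 < nu ->
  2 `^ (- nu) * bessel_sum nu e ((w / 2) ^+ 2) n @[n --> \oo] -->
  complex.Re (e * besselI_even nu w).
Proof.
move=> nu1; set q := (w / 2) ^+ 2.
have h1 := @is_cvg_bessel_sum nu 1 q nu1.
have h2 := @is_cvg_bessel_sum nu (- 'i%C) q nu1.
have E : besselI_even nu w = (2 `^ (- nu))%:C *
    (limn (bessel_sum nu 1 q) +i* limn (bessel_sum nu (- 'i%C) q)).
  rewrite /besselI_even; congr (_ * _).
  have ReIm (P : R[i] -> R) (d : R[i]) : {morph P : x y / x + y} -> P 0 = 0 ->
      (forall x, P x = complex.Re (d * x)) -> forall n,
    P (series ((fun k => (w / 2) ^+ (2 * k) /
       (k`!%:R * Gamma (nu + k%:R + 1))%:C) : nat -> R[i]^o) n) = bessel_sum nu d q n.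
    move=> PD P0 PE n; rewrite /series/= big_mkord (big_morph P PD P0).
    apply: eq_bigr => k _; rewrite PE exprM -fmorphV/= mulrA Re_mul_real.
    by [].
  apply: limn_complex.
  - rewrite (_ : (fun n => _) = bessel_sum nu 1 q)//.
    apply/funext => n; apply: ReIm => // [[? ?] [? ?]|x]//.
    by rewrite mul1r.
  - rewrite (_ : (fun n => _) = bessel_sum nu (- 'i%C) q)//.
    apply/funext => n; apply: ReIm => // [[? ?] [? ?]|[? ?]]//=.
    by ring.
rewrite E mulrCA mulrC Re_mul_real mulrC.
apply: cvgM; first exact: cvg_cst.
rewrite (funext (bessel_sum_lin nu e q)).
have -> : complex.Re (e * (limn (bessel_sum nu 1 q) +i* limn (bessel_sum nu (- 'i%C) q)))
   = complex.Re e * limn (bessel_sum nu 1 q)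
     - complex.Im e * limn (bessel_sum nu (- 'i%C) q) by case: e.
by apply: cvgB; apply: cvgM => //; exact: cvg_cst.
Qed.

End BesselSeries.

(** * The mixture kernel and its domination *)

Section PlaneMeasure.
Context {R : realType}.
Notation mu := (@lebesgue_measure R).

(* [product_measure1] carries no usable sigma-finite canonical structure on
   non-probability factors, hence this copy of [planar_measure]. *)
Definition plane_measure := (mu \x mu)%E.

HB.instance Definition _ := Measure.on plane_measure.

Let plane_measure_sigma_finite : sigma_finite setT plane_measure.
Proof.
have /sigma_finiteP[F [TF ndF Foo]] := sigma_finiteT mu.
exists (fun n => F n `*` F n).
  apply/seteqP; split => [[x y] _|//].
  have [n _ Fx] : (\bigcup_i F i) x by rewrite -TF.
  have [k _ Fy] : (\bigcup_i F i) y by rewrite -TF.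
  exists (maxn n k) => //; split => /=.
    by apply: (subsetPset _ _ (ndF _ _ (leq_maxl n k))).
  by apply: (subsetPset _ _ (ndF _ _ (leq_maxr n k))).
move=> k; have [? ?] := Foo k.
split; first exact: measurableX.
by rewrite /plane_measure product_measure1E// lte_mul_pinfty// ge0_fin_numE.
Qed.

HB.instance Definition _ := Measure_isSigmaFinite.Build _ _ _ plane_measure
  plane_measure_sigma_finite.

End PlaneMeasure.

Section KernelDomination.
Context {R : realType}.
Variables (alpha nu : R).
Hypotheses (alpha0 : 0 < alpha) (nu1 : -1 < nu).
Notation mu := (@lebesgue_measure R).

Definition mixing_rate s : R := (alpha / 6) ^+ 2 * expR (- s).

Definition mixing_weight s : R := expR (nu * s - expR s).

Definition bessel_kernel (us : (R * R) * R) : R :=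
  mixing_weight us.2 * gauss_plane (mixing_rate us.2) (- (alpha / 6)) us.1.

(** A majorant of [exp (d |x| + c x - b x^2)] free of absolute values, hence with an explicit
    integral. *)
Definition two_gauss b c d x : R :=
  expR ((c + d) * x - b * x ^+ 2) + expR ((c - d) * x - b * x ^+ 2).

(** The allowance [alpha / 12] is half of the margin [alpha / 6] between the decay of [K_nu] and the
    growth of [exp (- alpha Re u / 6)]. *)
Definition kernel_dominator (us : (R * R) * R) : R :=
  mixing_weight us.2 *
    (two_gauss (mixing_rate us.2) (- (alpha / 6)) (alpha / 12) us.1.1 *
     two_gauss (mixing_rate us.2) 0 (alpha / 12) us.1.2).

Lemma mixing_rate_gt0 s : 0 < mixing_rate s.
Proof. by rewrite mulr_gt0 ?expR_gt0// exprn_gt0// divr_gt0. Qed.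

Lemma two_gauss_ge0 b c d x : 0 <= two_gauss b c d x.
Proof. by rewrite addr_ge0 ?expR_ge0. Qed.

Lemma kernel_dominator_ge0 us : 0 <= kernel_dominator us.
Proof. by rewrite !mulr_ge0 ?expR_ge0 ?two_gauss_ge0. Qed.

Lemma bessel_kernel_ge0 us : 0 <= bessel_kernel us.
Proof. by rewrite !mulr_ge0 ?expR_ge0. Qed.

Lemma expR_norm_gauss_le b c d x : 0 <= d ->
  expR (d * `|x|) * expR (c * x - b * x ^+ 2) <= two_gauss b c d x.
Proof.
move=> d0; have -> : d * `|x| = `|d * x| by rewrite normrM (ger0_norm d0).
apply: (le_trans (ler_wpM2r (expR_ge0 _) (expR_norm_le (d * x)))).
rewrite mulrDl -!expRD; apply: lerD; rewrite ler_expR le_eqVlt;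
  by apply/orP; left; apply/eqP; ring.
Qed.

Lemma bessel_kernel_le us :
  expR (alpha / 12 * (`|us.1.1| + `|us.1.2|)) * bessel_kernel us <= kernel_dominator us.
Proof.
have d0 : 0 <= alpha / 12 by rewrite divr_ge0// ltW.
rewrite /bessel_kernel /kernel_dominator /gauss_plane mulrCA ler_wpM2l ?expR_ge0//.
rewrite mulrDr expRD mulrACA.
by apply: ler_pM; rewrite ?mulr_ge0 ?expR_ge0 ?expR_norm_gauss_le.
Qed.

Lemma measurable_mixing_weight :
  measurable_fun [set: (R * R) * R] (fun us => mixing_weight us.2).
Proof.
rewrite /mixing_weight; apply: measurableT_comp => //; apply: measurable_funB.
  by apply: measurable_funM => //; exact: measurable_snd.
by apply: measurableT_comp => //; exact: measurable_snd.
Qed.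

Lemma measurable_gauss_mix c (f : (R * R) * R -> R) :
  measurable_fun [set: (R * R) * R] f ->
  measurable_fun [set: (R * R) * R]
    (fun us => expR (c * f us - mixing_rate us.2 * f us ^+ 2)).
Proof.
move=> mf; apply: measurableT_comp => //; apply: measurable_funB.
  exact: measurable_funM.
apply: measurable_funM; last exact: measurable_funX.
apply: measurable_funM => //; apply: measurableT_comp => //.
by apply: measurableT_comp => //; exact: measurable_snd.
Qed.

Let mx : measurable_fun [set: (R * R) * R] (fun us => us.1.1).
Proof. by apply: (measurableT_comp measurable_fst); exact: measurable_fst. Qed.

Let my : measurable_fun [set: (R * R) * R] (fun us => us.1.2).
Proof. by apply: (measurableT_comp measurable_snd); exact: measurable_fst. Qed.

Lemma measurable_bessel_kernel : measurable_fun setT bessel_kernel.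
Proof.
apply: measurable_funM; first exact: measurable_mixing_weight.
by apply: measurable_funM; exact: measurable_gauss_mix.
Qed.

Lemma measurable_kernel_dominator : measurable_fun setT kernel_dominator.
Proof.
apply: measurable_funM; first exact: measurable_mixing_weight.
by apply: measurable_funM; apply: measurable_funD; exact: measurable_gauss_mix.
Qed.

Lemma integrable_two_gauss b c d : 0 < b ->
  mu.-integrable setT (EFin \o two_gauss b c d).
Proof.
move=> b0; apply: eq_integrable (integrableD measurableT
  (integrable_gauss (c + d) b0) (integrable_gauss (c - d) b0)) => // x _ /=.
Qed.

Lemma integral_two_gauss b c d : 0 < b ->
  \int[mu]_x two_gauss b c d x = Num.sqrt (pi / b) *
    (expR ((c + d) ^+ 2 / (4 * b)) + expR ((c - d) ^+ 2 / (4 * b))).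
Proof.
move=> b0; rewrite /two_gauss RintegralD//; try exact: integrable_gauss.
by rewrite /Rintegral !integral_gauss//= mulrDr.
Qed.

Lemma mixing_exponent s c : c / (4 * mixing_rate s) = c * (9 / alpha ^+ 2) * expR s.
Proof.
rewrite /mixing_rate expRN; field.
by rewrite (gt_eqF alpha0) (gt_eqF (expR_gt0 s)).
Qed.

Lemma mixing_norm s : pi / mixing_rate s = pi * (36 / alpha ^+ 2) * expR s.
Proof.
rewrite /mixing_rate expRN; field.
by rewrite (gt_eqF alpha0) (gt_eqF (expR_gt0 s)).
Qed.

(** With the plane integrated first, the largest exponents are [9/16 e^s] from [u.1] and [1/16 e^s]
    from [u.2]. Against the weight [exp (- e^s)] this leaves [exp (- 3/8 e^s)], and the
    normalisation [pi / b] supplies the [e^s] that raises [nu] to [nu + 1 > 0]. *)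
Lemma integrable_kernel_dominator :
  (plane_measure \x mu)%E.-integrable setT (EFin \o kernel_dominator).
Proof.
have mED : measurable_fun setT (EFin \o kernel_dominator).
  by apply/measurable_EFinP; exact: measurable_kernel_dominator.
apply/integrable21ltyP; first exact: mED.
under eq_integral => s _.
  under eq_integral do rewrite /= ger0_norm ?kernel_dominator_ge0//.
  over.
(* The factor 4 counts the products of two exponentials, each bounded by the largest; the rest is
   [pi / b] without its [e^s]. *)
pose C : R := 4 * (pi * (36 / alpha ^+ 2)).
have C0 : 0 <= C by rewrite !mulr_ge0 ?pi_ge0// ?invr_ge0 ?sqr_ge0.
apply: (@le_lt_trans _ _ (\int[mu]_s
    (C%:E * (expR ((nu + 1) * s - 3 / 8 * expR s))%:E))%E); last first.
  have nu0 : 0 < nu + 1 by rewrite -ltrBlDr sub0r.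
  rewrite ge0_integralZl_EFin//.
    by rewrite integral_expR_kernel_Gamma ?divr_gt0// -EFinM ltry.
  apply/measurable_EFinP; apply: continuous_measurable_fun.
  have := @continuous_expR_kernel R (nu + 1) (3 / 8) 0.
  by under eq_fun do rewrite mul0r subr0.
have mD := measurable_kernel_dominator.
apply: ge0_le_integral => //.
- by move=> s _; apply: integral_ge0 => u _; rewrite lee_fin kernel_dominator_ge0.
- apply: (@measurable_fun_fubini_tonelli_G _ _ _ _ R plane_measure _ mED) => us.
  by rewrite lee_fin kernel_dominator_ge0.
- apply/measurable_EFinP; apply: measurable_funM => //; apply: continuous_measurable_fun.
  have := @continuous_expR_kernel R (nu + 1) (3 / 8) 0.
  by under eq_fun do rewrite mul0r subr0.
move=> s _; have b0 := mixing_rate_gt0 s; set b := mixing_rate s in b0.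
have i1 := integrable_two_gauss (- (alpha / 6)) (alpha / 12) b0.
have i2 := integrable_two_gauss 0 (alpha / 12) b0.
have i12 := integrable_prod_mul i1 i2.
under eq_integral do rewrite /kernel_dominator/= EFinM.
rewrite integralZl//.
rewrite -[X in (_ * X)%E]fineK; last exact: integrable_fin_num i12.
rewrite -/(Rintegral _ _ _) (Rintegral_prod_mul i1 i2) !integral_two_gauss//.
rewrite -!EFinM lee_fin.
have e1 (c d : R) (k : R) : (c + d) ^+ 2 * (9 / alpha ^+ 2) = k ->
    expR ((c + d) ^+ 2 / (4 * b)) = expR (k * expR s).
  by move=> <-; rewrite /b mixing_exponent.
have a1 : alpha != 0 by rewrite gt_eqF.
rewrite (e1 _ _ (1 / 16)); last by field.
rewrite (e1 _ _ (9 / 16)); last by field.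
rewrite (e1 _ _ (1 / 16)); last by field.
rewrite (e1 _ _ (1 / 16)); last by field.
rewrite mulrACA -expr2 sqr_sqrtr ?divr_ge0 ?pi_ge0 ?(ltW b0)// /b mixing_norm.
have le1 : expR (1 / 16 * expR s) <= expR (9 / 16 * expR s).
  by rewrite ler_expR ler_wpM2r ?expR_ge0//; lra.
apply: (@le_trans _ _ (mixing_weight s * (pi * (36 / alpha ^+ 2) * expR s *
    ((expR (9 / 16 * expR s) + expR (9 / 16 * expR s)) *
     (expR (1 / 16 * expR s) + expR (1 / 16 * expR s)))))).
  rewrite ler_wpM2l ?expR_ge0// ler_wpM2l ?mulr_ge0 ?pi_ge0 ?expR_ge0//.
    by rewrite invr_ge0 sqr_ge0.
  by rewrite ler_wpM2r ?addr_ge0 ?expR_ge0// lerD2r.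
have -> : expR ((nu + 1) * s - 3 / 8 * expR s) = mixing_weight s * expR s *
    (expR (9 / 16 * expR s) * expR (1 / 16 * expR s)).
  by rewrite /mixing_weight -!expRD; congr expR; field.
by rewrite le_eqVlt; apply/orP; left; apply/eqP; rewrite /C; ring.
Qed.

Variable z : R[i].

Definition series_arg (u : R * R) : R[i] :=
  (alpha ^+ 2 / 16)%:C * z * (u.1 -i* u.2).

(** The value of [m] in the Gamma bound: since [e^(-m) m <= 1], it brings [e^(-m) |series_arg u|]
    down to at most [alpha / 12 |u|], whatever the size of [z]. *)
Definition series_rate : R :=  alpha ^+ 2 / 16 * cmod z / (alpha / 12).

Lemma cmod_series_arg u :
  expR (- series_rate) * cmod (series_arg u) <= alpha / 12 * (`|u.1| + `|u.2|).
Proof.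
have d0 : 0 < alpha / 12 by rewrite divr_gt0.
have c0 : 0 <= alpha ^+ 2 / 16 by rewrite divr_ge0 ?sqr_ge0.
have -> : cmod (series_arg u) =
    series_rate * (alpha / 12) * cmod (u.1 -i* u.2).
  rewrite /series_arg !cmodM /series_rate divfK ?gt_eqF//; congr (_ * _ * _).
  by rewrite cmod_normc /= expr0n/= addr0 sqrtr_sqr ger0_norm.
rewrite mulrA; apply: ler_pM;
  rewrite ?cmod_ge0 ?mulr_ge0 ?expR_ge0 ?invr_ge0 ?cmod_ge0 ?(ltW alpha0) //.
- exact: ltW d0.
- rewrite mulrA ler_piMl ?(ltW d0)// expRN mulrC ler_pdivrMr ?expR_gt0// mul1r.
  by apply: le_trans (expR_ge1Dx _); rewrite lerDr.
- by apply: le_trans (cmod_le_norm1 _ _) _; rewrite normrN.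
Qed.

Definition bessel_term e k (us : (R * R) * R) : R :=
  complex.Re (e * series_arg us.1 ^+ k) * bessel_coef nu k * bessel_kernel us.

Definition domination_const e : R :=
  cmod e * expR (expR (series_rate + 1) - (nu + 1) * series_rate).

Lemma domination_const_ge0 e : 0 <= domination_const e.
Proof. by rewrite mulr_ge0 ?cmod_ge0 ?expR_ge0. Qed.

Lemma bessel_sum_kernel_le e n us :
  `|bessel_sum nu e (series_arg us.1) n * bessel_kernel us| <=
  domination_const e * kernel_dominator us.
Proof.
rewrite normrM (ger0_norm (bessel_kernel_ge0 us)).
apply: le_trans (ler_wpM2r (bessel_kernel_ge0 us)
  (bessel_sum_le e (series_arg us.1) series_rate n nu1)) _.
rewrite -/(domination_const e) -mulrA ler_wpM2l ?domination_const_ge0//.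
apply: le_trans (bessel_kernel_le us).
by rewrite ler_wpM2r ?bessel_kernel_ge0// ler_expR cmod_series_arg.
Qed.

Lemma bessel_sumS e us n :
  bessel_sum nu e (series_arg us.1) n.+1 * bessel_kernel us =
  bessel_sum nu e (series_arg us.1) n * bessel_kernel us + bessel_term e n us.
Proof. by rewrite /bessel_sum big_ord_recr/= mulrDl. Qed.

Lemma measurable_Re_antiholo e k :
  measurable_fun [set: R * R] (fun u => complex.Re (e * (u.1 -i* u.2) ^+ k)).
Proof.
elim: k e => [|k IH] e.
  by under eq_fun do rewrite expr0; exact: measurable_cst.
have -> : (fun u : R * R => complex.Re (e * (u.1 -i* u.2) ^+ k.+1)) =
    (fun u => complex.Re (e * (u.1 -i* u.2) ^+ k) * u.1
      + complex.Re (e * - 'i%C * (u.1 -i* u.2) ^+ k) * u.2).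
  apply/funext => u; rewrite -!Re_mul_real -Re_add; congr complex.Re.
  have -> : u.1 -i* u.2 = u.1%:C - 'i%C * u.2%:C by simpc.
  by rewrite exprSr; ring.
by apply: measurable_funD; apply: measurable_funM.
Qed.

Lemma bessel_termE e k us : bessel_term e k us =
  complex.Re (e * ((alpha ^+ 2 / 16)%:C * z) ^+ k * (us.1.1 -i* us.1.2) ^+ k)
    * bessel_coef nu k * bessel_kernel us.
Proof. by rewrite /bessel_term /series_arg exprMn [e * (_ * _)]mulrA. Qed.

Lemma measurable_bessel_term e k : measurable_fun setT (bessel_term e k).
Proof.
rewrite (funext (bessel_termE e k)).
apply: measurable_funM; last exact: measurable_bessel_kernel.
apply: measurable_funM => //.
apply: (measurableT_comp (measurable_Re_antiholo _ _)); exact: measurable_fst.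
Qed.

Lemma integrable_bessel_sum e n : (plane_measure \x mu)%E.-integrable setT
  (fun us => (bessel_sum nu e (series_arg us.1) n * bessel_kernel us)%:E).
Proof.
apply: le_integrable (integrableZl measurableT (domination_const e)
  integrable_kernel_dominator) => //.
  apply/measurable_EFinP; elim: n => [|n IH].
    by under eq_fun do rewrite /bessel_sum big_ord0 mul0r; exact: measurable_cst.
  rewrite (funext (fun us => bessel_sumS e us n)).
  by apply: measurable_funD => //; exact: measurable_bessel_term.
move=> us _ /=; rewrite lee_fin [leRHS]ger0_norm; first exact: bessel_sum_kernel_le.
by rewrite mulr_ge0 ?domination_const_ge0 ?kernel_dominator_ge0.
Qed.

Lemma integrable_bessel_term e k :
  (plane_measure \x mu)%E.-integrable setT (EFin \o bessel_term e k).
Proof.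
apply: eq_integrable (integrableB measurableT (integrable_bessel_sum e k.+1)
  (integrable_bessel_sum e k)) => // us _.
by rewrite /= -EFinB bessel_sumS addrAC subrr add0r.
Qed.

(** The part common to all [k]: [pi * 36 / alpha^2] comes from [pi / b], and [(3/4)^(-(nu + 1))]
    from the Gamma integral of rate 3/4. *)
Definition mixing_const : R :=
  pi * (36 / alpha ^+ 2) * (3 / 4) `^ (- (nu + 1)).

(** The Gaussian moment has ratio [- (3 / alpha) e^s], so the integral over [s] is
    [Gamma (nu + k + 1) (3/4)^(-(nu + k + 1))]. Each order thus contributes [alpha^2 z / 16 * (- 3 /
    alpha) * 4/3 = - alpha z / 4]. *)
Lemma Rintegral_bessel_term e k :
  \int[(plane_measure \x mu)%E]_us bessel_term e k us =
  mixing_const * (complex.Re (e * (- (alpha%:C * z / 4)) ^+ k) * (1 ^+ k / k`!%:R)).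
Proof.
have it := integrable_bessel_term e k.
rewrite /Rintegral -integral21_prod_meas1//.
set e' := e * ((alpha ^+ 2 / 16)%:C * z) ^+ k.
pose C := bessel_coef nu k * complex.Re (e' * (- (3 / alpha))%:C ^+ k) *
  (pi * (36 / alpha ^+ 2)).
have x0 := bessel_arg_gt0 k nu1.
have cE : continuous (fun s : R => expR ((nu + k%:R + 1) * s - 3 / 4 * expR s)).
  have := @continuous_expR_kernel R (nu + k%:R + 1) (3 / 4) 0.
  by under eq_fun do rewrite mul0r subr0.
have int0 : (\int[mu]_s (expR ((nu + k%:R + 1) * s - 3 / 4 * expR s))%:E =
    (Gamma (nu + k%:R + 1) * (3 / 4) `^ (- (nu + k%:R + 1)))%:E)%E.
  by rewrite integral_expR_kernel_Gamma// divr_gt0.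
have intE : mu.-integrable setT
    (fun s => (expR ((nu + k%:R + 1) * s - 3 / 4 * expR s))%:E).
  apply/integrableP; split; first by apply/measurable_EFinP; exact: continuous_measurable_fun.
  by under eq_integral do rewrite gee0_abs ?lee_fin ?expR_ge0//; rewrite int0 ltry.
have -> : (\int[mu]_s fubini_G plane_measure (fun us => (bessel_term e k us)%:E) s =
   \int[mu]_s (C%:E * (expR ((nu + k%:R + 1) * s - 3 / 4 * expR s))%:E))%E.
  apply: eq_integral => s _; rewrite /fubini_G.
  have [ig Ig] := integral_gauss_plane_antiholo (- (alpha / 6)) e' k (mixing_rate_gt0 s).
  under eq_integral => u _.
    rewrite bessel_termE -/e' /bessel_kernel/=.
    rewrite (_ : _ * _ * _ = bessel_coef nu k * mixing_weight s *
      (complex.Re (e' * (u.1 -i* u.2) ^+ k) *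
       gauss_plane (mixing_rate s) (- (alpha / 6)) u)); last by ring.
    rewrite EFinM; over.
  rewrite integralZl// -[X in (_ * X)%E]fineK; last exact: integrable_fin_num ig.
  rewrite -/(Rintegral _ _ _) Ig -!EFinM; congr (_%:E).
  rewrite mixing_exponent mixing_norm.
  have -> : - (alpha / 6) / (2 * mixing_rate s) = - (3 / alpha) * expR s.
    rewrite /mixing_rate expRN; field.
    by rewrite (gt_eqF alpha0) (gt_eqF (expR_gt0 s)).
  have -> : e' * (- (3 / alpha) * expR s)%:C ^+ k =
      e' * (- (3 / alpha))%:C ^+ k * (expR (k%:R * s))%:C.
    by rewrite expRM_natl rmorphXn -mulrA -exprMn -rmorphM.
  rewrite Re_mul_real.
  (* The Gaussian integral returns [exp (e^s / 4)]; together with [exp (- e^s)] this is the rate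
     3/4. *)
  have -> : (- (alpha / 6)) ^+ 2 * (9 / alpha ^+ 2) = 1 / 4.
    by field; rewrite gt_eqF.
  have -> : expR ((nu + k%:R + 1) * s - 3 / 4 * expR s) =
     mixing_weight s * expR (k%:R * s) * (expR s * expR (1 / 4 * expR s)).
    by rewrite /mixing_weight -!expRD; congr expR; field.
  by rewrite /C; ring.
rewrite integralZl// int0 -EFinM/=.
have -> : - (nu + k%:R + 1) = - (nu + 1) + - k%:R by ring.
rewrite powRD; last by apply/implyP => _; rewrite gt_eqF// divr_gt0.
rewrite (powRN _ k%:R) powR_mulrn ?divr_ge0// /C /bessel_coef /mixing_const.
have k0 : k`!%:R != 0 :> R by rewrite pnatr_eq0 -lt0n fact_gt0.
have G0 : Gamma (nu + k%:R + 1) != 0 by rewrite gt_eqF// Gamma_gt0.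
have -> : complex.Re (e * (- (alpha%:C * z / 4)) ^+ k) =
    complex.Re (e' * (- (3 / alpha))%:C ^+ k) / (3 / 4) ^+ k.
  have -> : - (alpha%:C * z / 4) =
      (alpha ^+ 2 / 16)%:C * z * (- (3 / alpha))%:C * ((3 / 4)^-1)%:C.
    have a1 : alpha != 0 by rewrite gt_eqF.
    transitivity (z * (alpha ^+ 2 / 16 * - (3 / alpha) * (3 / 4)^-1)%:C); last first.
      by rewrite !rmorphM/=; ring.
    have -> : alpha ^+ 2 / 16 * - (3 / alpha) * (3 / 4)^-1 = - (alpha / 4) by field.
    by rewrite rmorphN rmorphM/= fmorphV rmorph_nat; ring.
  rewrite -exprVn -Re_mul_real rmorphXn/= /e'; congr complex.Re.
  by set A := _ * z; rewrite [in LHS]exprMn [in LHS]exprMn !mulrA.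
rewrite expr1n; field.
by rewrite k0 G0 (gt_eqF alpha0) gt_eqF// exprn_gt0// divr_gt0.
Qed.

End KernelDomination.

(** * Changing an integrand at the origin *)

Section OffOrigin.
Context {R : realType}.
Notation mu := (@lebesgue_measure R).
Notation plane := (@plane_measure R).

Lemma plane_measure_origin : plane ([set 0] `*` [set 0]) = 0%E.
Proof.
rewrite /plane_measure product_measure1E//.
by rewrite [X in (X * _)%E](_ : _ = 0%E) ?mul0e//; exact: lebesgue_measure_set1.
Qed.

(** At the origin the integral over [s] of the kernel is that of [exp (nu s - e^s)], infinite for
    [nu <= 0], and does not match the default values in the integrand. Hence [f] is extended-real
    and is compared with [g] off a null point only. *)
Lemma integral_off_origin (f : R * R -> \bar R) (g : R * R -> R) :
  plane.-integrable setT f -> (forall p, p != (0, 0) -> f p = (g p)%:E) ->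
  plane.-integrable setT (fun p => (g p)%:E) /\ \int[plane]_p g p = fine (\int[plane]_p f p)%E.
Proof.
move=> intf fg; set N := ([set 0] `*` [set 0]) : set (R * R).
have mN : measurable N by exact: measurableX.
have mf := measurable_int _ intf.
have gE : (fun p => (g p)%:E) = fun p => if (p.1 == 0) && (p.2 == 0) then (g (0, 0))%:E else f p.
  apply/funext => -[x y] /=.
  have [->|x0] := eqVneq x 0; have [->|y0] := eqVneq y 0 => //=; rewrite fg//;
    by rewrite xpair_eqE ?(negbTE x0) ?(negbTE y0) ?andbF.
have mg : measurable_fun setT (fun p => (g p)%:E).
  rewrite gE; apply: measurable_fun_ifT => //.
  by apply: measurable_and; apply: measurable_fun_eqr.
have fgN p : ~ N p -> f p = (g p)%:E.
  move=> Np; apply: fg; apply/eqP => p0; apply: Np; rewrite p0; split => //.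
split.
- apply: (proj2 (@negligible_integrable _ _ _ plane setT N _ mN measurableT mg
    plane_measure_origin)).
  have := proj1 (@negligible_integrable _ _ _ plane setT N _ mN measurableT mf
    plane_measure_origin) intf.
  apply: eq_integrable; first exact: measurableD.
  by move=> p; rewrite inE/= => -[_ /fgN].
- congr fine; apply: ae_eq_integral => //.
  exists N; split => // [|p /= h]; first exact: plane_measure_origin.
  by apply: contrapT => /fgN fgp; apply: h => _.
Qed.

End OffOrigin.

(** * The planar integral of the even factor of [I_nu] *)

Section WeightedPlaneIntegral.
Context {R : realType}.
Variables (alpha nu : R) (z : R[i]).
Hypotheses (alpha0 : 0 < alpha) (nu1 : -1 < nu).
Notation mu := (@lebesgue_measure R).
Notation plane := (@plane_measure R).

Definition bessel_arg (u : R * R) : R[i] :=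
  (alpha / 2)%:C * (sqrtc z * conjc (sqrtc (u.1 +i* u.2))).

Definition weight_besselK (u : R * R) : R :=
  expR (- (6^-1 * alpha * u.1)) *
  (2 * (alpha * cmod (u.1 +i* u.2) / 3 / 2) `^ nu *
   besselK nu (alpha * cmod (u.1 +i* u.2) / 3)).

Lemma conjcM (v w : R[i]) : conjc (v * w) = conjc v * conjc w.
Proof.
by case: v w => [a b] [c d]; apply/eqP; rewrite eq_complex/=; apply/andP; split; apply/eqP; ring.
Qed.

(** Only the square of the argument enters the even factor, so the roots recombine into
    [z * conj u]. *)
Lemma series_argE u : (bessel_arg u / 2) ^+ 2 = series_arg alpha z u.
Proof.
have -> : series_arg alpha z u = (alpha ^+ 2 / 16)%:C * (sqrtc z) ^+ 2 *
    (conjc (sqrtc (u.1 +i* u.2)) * conjc (sqrtc (u.1 +i* u.2))).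
  by rewrite /series_arg sqr_sqrtc -conjcM -expr2 sqr_sqrtc.
rewrite /bessel_arg !rmorphM !fmorphV !rmorph_nat.
by field.
Qed.

Lemma integral_bessel_sum e n :
  \int[(plane \x mu)%E]_us (bessel_sum nu e (series_arg alpha z us.1) n * bessel_kernel alpha nu us)
  = mixing_const alpha nu * Re_cexp_sum e (- (alpha%:C * z / 4)) n 1.
Proof.
elim: n => [|n IH].
  rewrite /Re_cexp_sum big_ord0 mulr0 /Rintegral.
  by under eq_integral do rewrite /bessel_sum big_ord0 mul0r; rewrite integral0.
under eq_Rintegral do rewrite bessel_sumS.
rewrite RintegralD//; last 2 first.
  exact: integrable_bessel_sum.
  exact: integrable_bessel_term.
by rewrite IH Rintegral_bessel_term// -mulrDr /Re_cexp_sum big_ord_recr.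
Qed.

Definition Re_bessel_even e u : R := complex.Re (e * besselI_even nu (bessel_arg u)).

(** Dominated convergence along the partial sums, whose integrals are multiples of the partial sums
    of the exponential series; uniqueness of limits identifies the two. *)
Lemma integral_besselI_kernel e :
  (plane \x mu)%E.-integrable setT
    (fun us => (Re_bessel_even e us.1 * bessel_kernel alpha nu us)%:E) /\
  \int[(plane \x mu)%E]_us (Re_bessel_even e us.1 * bessel_kernel alpha nu us) =
  2 `^ (- nu) * mixing_const alpha nu * complex.Re (e * cexp (- (alpha%:C * z / 4))).
Proof.
pose fn n us := 2 `^ (- nu) *
  (bessel_sum nu e (series_arg alpha z us.1) n * bessel_kernel alpha nu us).
have ifn n : (plane \x mu)%E.-integrable setT (EFin \o fn n).
  by have := integrableZl measurableT (2 `^ (- nu)) (integrable_bessel_sum alpha0 nu1 z e n).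
have cfn us : fn n us @[n --> \oo] --> Re_bessel_even e us.1 * bessel_kernel alpha nu us.
  rewrite /fn; under eq_fun do rewrite mulrA.
  apply: cvgM; last exact: cvg_cst.
  by rewrite -series_argE; exact: cvg_besselI_even.
have mf : measurable_fun setT (fun us => Re_bessel_even e us.1 * bessel_kernel alpha nu us).
  apply: (@measurable_fun_cvg _ _ _ setT fn) => //.
  by move=> n; apply/measurable_EFinP; exact: measurable_int (ifn n).
have intg := integrableZl measurableT (2 `^ (- nu) * domination_const alpha nu z e)
  (integrable_kernel_dominator alpha0 nu1).
have [] := @dominated_convergence _ _ _ (plane \x mu)%E setT measurableT
  (fun n => EFin \o fn n)
  (EFin \o (fun us => Re_bessel_even e us.1 * bessel_kernel alpha nu us)) _ _ _ _ intg.
- by move=> n; exact: measurable_int (ifn n).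
- exact/measurable_EFinP.
- by apply: aeW => us _; apply: cvg_EFin; [exact: nearW|exact: cfn].
- apply: aeW => us n _ /=; rewrite lee_fin normrM ger0_norm ?powR_ge0// -mulrA.
  by rewrite ler_wpM2l ?powR_ge0// bessel_sum_kernel_le.
move=> intf _ cf; split; first exact: intf.
have cI : (2 `^ (- nu) * mixing_const alpha nu * Re_cexp_sum e (- (alpha%:C * z / 4)) n 1)%:E
    @[n --> \oo] --> (2 `^ (- nu) * mixing_const alpha nu *
      complex.Re (e * cexp (- (alpha%:C * z / 4))))%:E.
  apply: cvg_EFin; first exact: nearW.
  by apply: cvgM; [exact: cvg_cst|exact: cvg_Re_cexp_sum].
have E : [sequence (\int[(plane \x mu)%E]_us (EFin \o fn n) us)%E]_n =
    (fun n => (2 `^ (- nu) * mixing_const alpha nu *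
       Re_cexp_sum e (- (alpha%:C * z / 4)) n 1)%:E).
  apply/funext => n /=; rewrite -mulrA -integral_bessel_sum -RintegralZl//.
    by rewrite /Rintegral fineK//; exact: integrable_fin_num (ifn n).
  exact: integrable_bessel_sum.
by rewrite E in cf; rewrite /Rintegral (cvg_unique _ cf cI).
Qed.

Lemma bessel_kernelE u s : bessel_kernel alpha nu (u, s) =
  expR (- (6^-1 * alpha * u.1)) *
  expR (nu * s - expR s - (alpha * cmod (u.1 +i* u.2) / 3 / 2) ^+ 2 * expR (- s)).
Proof.
rewrite /bessel_kernel /mixing_weight /gauss_plane /mixing_rate/= -!expRD; congr expR.
have -> : (alpha * cmod (u.1 +i* u.2) / 3 / 2) ^+ 2 =
    alpha ^+ 2 / 36 * (u.1 ^+ 2 + u.2 ^+ 2).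
  rewrite -(@sqr_sqrtr _ (u.1 ^+ 2 + u.2 ^+ 2)) ?addr_ge0 ?sqr_ge0//.
  by rewrite /cmod/=; field.
by field.
Qed.

Lemma integral_bessel_kernel u : u != (0, 0) ->
  (\int[mu]_s (bessel_kernel alpha nu (u, s))%:E = (weight_besselK u)%:E)%E.
Proof.
case: u => x y u0; set r := alpha * cmod (x +i* y) / 3.
have r0 : 0 < r.
  rewrite divr_gt0// mulr_gt0// sqrtr_gt0/= lt_neqAle addr_ge0 ?sqr_ge0// andbT eq_sym.
  by rewrite paddr_eq0 ?sqr_ge0// !sqrf_eq0; apply: contra u0 => /andP[/eqP -> /eqP ->].
under eq_integral do rewrite bessel_kernelE EFinM.
rewrite ge0_integralZl_EFin ?expR_ge0//; last first.
  apply/measurable_EFinP; apply: continuous_measurable_fun.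
  have := @continuous_expR_kernel R nu 1 ((r / 2) ^+ 2).
  by under eq_fun do rewrite mul1r.
by rewrite (integral_expR_kernel_besselK nu1 r0) -EFinM.
Qed.

Lemma integrable_bessel_kernel u : u != (0, 0) ->
  mu.-integrable setT (fun s => (bessel_kernel alpha nu (u, s))%:E).
Proof.
move=> u0; apply/integrableP; split.
  apply/measurable_EFinP; apply: (measurableT_comp (measurable_bessel_kernel alpha nu)).
  exact: measurable_fun_pair.
under eq_integral do rewrite gee0_abs ?lee_fin ?bessel_kernel_ge0//.
by rewrite integral_bessel_kernel// ltry.
Qed.

(** Fubini in the other order: integrating out [s] first restores the Macdonald function away from
    the origin. *)
Lemma integral_besselI_weight e (g : R * R -> R) :
  (forall u, u != (0, 0) -> g u = Re_bessel_even e u * weight_besselK u) ->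
  plane.-integrable setT (fun u => (g u)%:E) /\
  \int[plane]_u g u =
  2 `^ (- nu) * mixing_const alpha nu * complex.Re (e * cexp (- (alpha%:C * z / 4))).
Proof.
move=> gE; have [intf If] := integral_besselI_kernel e.
have intF := integrable_fubini_F intf.
have FE u : u != (0, 0) -> fubini_F mu (fun us =>
    (Re_bessel_even e us.1 * bessel_kernel alpha nu us)%:E) u = (g u)%:E.
  move=> u0; rewrite gE// EFinM -(integral_bessel_kernel u0) /fubini_F.
  by rewrite -integralZl//; exact: integrable_bessel_kernel.
have [ig ->] := integral_off_origin intF FE; split => //.
by rewrite -If integral12_prod_meas1.
Qed.

End WeightedPlaneIntegral.

(** * Principal powers *)

Section ComplexPowers.
Context {R : realType}.
Implicit Types (u v w : R[i]) (a r t nu : R).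

Definition polar r t : R[i] := (r * cos t) +i* (r * sin t).

Lemma cmod_polar r t : 0 <= r -> cmod (polar r t) = r.
Proof.
by move=> r0; rewrite /cmod/= !exprMn -mulrDr cos2Dsin2 mulr1 sqrtr_sqr ger0_norm.
Qed.

Lemma carg_polar r t : 0 < r -> - pi < t -> t <= pi -> carg (polar r t) = t.
Proof.
move=> r0 t1 t2; rewrite /carg cmod_polar ?(ltW r0)//= mulrAC divff ?gt_eqF// mul1r.
rewrite pmulr_rlt0//; have [s0|s0] := ltP (sin t) 0.
- have tn : t < 0.
    rewrite ltNge; apply/negP => t0.
    by have := sin_ge0_pi (introT andP (conj t0 t2)); rewrite leNgt s0.
  by rewrite -cosN cosK ?opprK// in_itv/= oppr_ge0 ltW//= lerNl ltW.
- rewrite cosK// in_itv/= t2 andbT leNgt; apply/negP => tn.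
  have : 0 < sin (- t) by apply: sin_gt0_pi; rewrite oppr_gt0 tn/= ltrNl.
  by rewrite sinN oppr_gt0 ltNge s0.
Qed.

Lemma cmod_gt0 w : w != 0 -> 0 < cmod w.
Proof.
case: w => x y; rewrite eq_complex/= => w0.
rewrite sqrtr_gt0/= lt_neqAle addr_ge0 ?sqr_ge0// andbT eq_sym.
by rewrite paddr_eq0 ?sqr_ge0// !sqrf_eq0.
Qed.

Lemma polar_carg w : w != 0 -> w = polar (cmod w) (carg w).
Proof.
move=> w0; have r0 := cmod_gt0 w0; have r1 : cmod w != 0 by rewrite gt_eqF.
have r2 : cmod w ^+ 2 = complex.Re w ^+ 2 + complex.Im w ^+ 2.
  by rewrite sqr_sqrtr// addr_ge0// sqr_ge0.
have h : -1 <= complex.Re w / cmod w <= 1.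
  by rewrite -ler_norml normrM normfV (gtr0_norm r0) ler_pdivrMr// mul1r normr_Re_le.
have ht : complex.Re w / cmod w \in `[-1, 1] by rewrite in_itv.
have s : sin (acos (complex.Re w / cmod w)) = `|complex.Im w| / cmod w.
  rewrite sin_acos// -[RHS]ger0_norm ?divr_ge0 ?(ltW r0)// -sqrtr_sqr; congr Num.sqrt.
  rewrite !exprMn exprVn real_normK ?num_real// r2.
  by field; rewrite -r2 expf_neq0.
apply/eqP; rewrite eq_complex /polar /carg/=; case: ifPn => [i0|]; last rewrite -leNgt => i0.
  rewrite cosN sinN acosK// s (ltr0_norm i0) mulrC divfK// eqxx/=.
  by rewrite mulNr opprK mulrC divfK.
by rewrite acosK// s (ger0_norm i0) mulrC divfK// eqxx/= mulrC divfK.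
Qed.

Lemma cexpD v w : cexp (v + w) = cexp v * cexp w.
Proof.
case: v w => [a b] [c d]; apply/eqP; rewrite eq_complex/= expRD cosD sinD.
by apply/andP; split; apply/eqP; ring.
Qed.

Lemma conjc_cexp w : conjc (cexp w) = cexp (conjc w).
Proof.
case: w => a b; apply/eqP; rewrite eq_complex/= cosN sinN.
by apply/andP; split; apply/eqP; ring.
Qed.

Lemma acos_le_pihalf (x : R) : 0 <= x -> x <= 1 -> acos x <= pi / 2.
Proof.
move=> x0 x1; rewrite leNgt; apply/negP => y1.
have hx : -1 <= x <= 1 by rewrite x1 andbT (le_trans _ x0)// lerN10.
have := acos_lepi hx; set y := acos x in y1 * => y2.
have : 0 < cos (- y + pi) by apply: cos_gt0_pihalf; apply/andP; split; lra.
by rewrite cosDpi cosN oppr_gt0 /y acosK ?in_itv//= ltNge x0.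
Qed.

(** A vanishing real part forces [u] to be real and nonpositive, where [sqrtc] takes the sign [+1].
    This closes the interval of arguments at [pi / 2] and opens it at [- pi / 2]. *)
Lemma sqrtc_im_ge0 u : complex.Re (sqrtc u) = 0 -> 0 <= complex.Im (sqrtc u).
Proof.
case: u => a b /= /eqP; rewrite sqrtr_eq0 => h.
have a0 : a <= - Num.sqrt (a ^+ 2 + b ^+ 2) by lra.
have r0 : 0 <= Num.sqrt (a ^+ 2 + b ^+ 2) by exact: sqrtr_ge0.
have r2 : Num.sqrt (a ^+ 2 + b ^+ 2) ^+ 2 = a ^+ 2 + b ^+ 2.
  by rewrite sqr_sqrtr// addr_ge0// sqr_ge0.
have b2 : b ^+ 2 = 0 by apply/eqP; rewrite eq_le sqr_ge0 andbT; nra.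
by move/eqP : b2; rewrite sqrf_eq0 => ->; rewrite mul1r sqrtr_ge0.
Qed.

Lemma carg_sqrtc u : u != 0 -> - (pi / 2) < carg (sqrtc u) <= pi / 2.
Proof.
move=> u0; have v0 : sqrtc u != 0 by rewrite sqrtc_eq0.
have r0 := cmod_gt0 v0; have im0 := @sqrtc_im_ge0 u.
have re0 : 0 <= complex.Re (sqrtc u) by case: (u) => a b /=; exact: sqrtr_ge0.
have x0 : 0 <= complex.Re (sqrtc u) / cmod (sqrtc u) by rewrite divr_ge0 ?(ltW r0).
have x1 : complex.Re (sqrtc u) / cmod (sqrtc u) <= 1.
  by rewrite ler_pdivrMr// mul1r (le_trans (ler_norm _))// normr_Re_le.
have p0 : 0 < pi :> R := pi_gt0 R.
have hx : -1 <= complex.Re (sqrtc u) / cmod (sqrtc u) <= 1.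
  by rewrite x1 andbT (le_trans _ x0)// lerN10.
have t0 := acos_ge0 hx; have t1 := acos_le_pihalf x0 x1.
rewrite /carg; case: ifPn => [i0|_]; last by apply/andP; split=> //; lra.
have t2 : acos (complex.Re (sqrtc u) / cmod (sqrtc u)) != pi / 2.
  apply/eqP => tE; have : cos (acos (complex.Re (sqrtc u) / cmod (sqrtc u))) = 0.
    by rewrite tE cos_pihalf.
  rewrite acosK ?in_itv//= => /eqP; rewrite mulf_eq0 invr_eq0 (gt_eqF r0) orbF.
  by move/eqP/im0; rewrite leNgt i0.
have {t2}t1 : acos (complex.Re (sqrtc u) / cmod (sqrtc u)) < pi / 2 by rewrite lt_neqAle t2.
by apply/andP; split; lra.
Qed.

Lemma cpow0r w : cpow w 0 = 1.
Proof.
rewrite /cpow; case: ifP; rewrite ?eqxx// => _.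
rewrite /cexp/= !mul0r subr0 addr0 expR0 cos0 sin0.
by apply/eqP; rewrite eq_complex/= !(mulr1, mulr0, mul0r, subr0, addr0) !eqxx.
Qed.

Lemma cpow_polarE w nu : w != 0 ->
  cpow w nu = cexp ((nu * ln (cmod w)) +i* (nu * carg w)).
Proof.
move=> w0; rewrite /cpow (negbTE w0); congr cexp.
by apply/eqP; rewrite eq_complex/= !mul0r subr0 addr0 !eqxx.
Qed.

(** The phases cancel: this is how [u^(nu/2)] and the conjugate power inside [I_nu] combine into the
    real weight [|u|^nu] of the mixture formula. *)
Lemma cpow_mul_conj u nu : u != 0 ->
  cpow (sqrtc u) nu * conjc (cpow (sqrtc u) nu) = (cmod u `^ nu)%:C.
Proof.
move=> u0; have v0 : sqrtc u != 0 by rewrite sqrtc_eq0.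
rewrite cpow_polarE// conjc_cexp -cexpD/=.
have -> : cmod u = cmod (sqrtc u) ^+ 2 by rewrite -cmodX sqr_sqrtc.
rewrite /powR gt_eqF ?exprn_gt0 ?cmod_gt0// lnXn ?cmod_gt0//.
apply/eqP; rewrite eq_complex /cexp/= subrr cos0 sin0.
rewrite !(mulr0, mul0r, subr0, addr0, mulr1) eqxx andbT.
by apply/eqP; congr expR; ring.
Qed.

(** Both roots have arguments in []- pi / 2, pi / 2]], so their difference lies strictly between
    [- pi] and [pi]: it is the principal argument of the product, and no branch jump occurs. *)
Lemma cpow_arg_mul a z u nu : 0 < a -> z != 0 -> u != 0 ->
  cpow (a%:C * (sqrtc z * conjc (sqrtc u))) nu =
  (a `^ nu)%:C * cpow (sqrtc z) nu * conjc (cpow (sqrtc u) nu).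
Proof.
move=> a0 z0 u0.
have w0 : sqrtc z != 0 by rewrite sqrtc_eq0.
have v0 : sqrtc u != 0 by rewrite sqrtc_eq0.
have /andP[z1 z2] := carg_sqrtc z0; have /andP[u1 u2] := carg_sqrtc u0.
set r := a * (cmod (sqrtc z) * cmod (sqrtc u)).
set t := carg (sqrtc z) - carg (sqrtc u).
have r0 : 0 < r by rewrite !mulr_gt0 ?cmod_gt0.
have E : a%:C * (sqrtc z * conjc (sqrtc u)) = polar r t.
  rewrite {1}(polar_carg w0) {1}(polar_carg v0) /polar /t cosB sinB /r.
  by apply/eqP; rewrite eq_complex/=; apply/andP; split; apply/eqP; ring.
have p0 : polar r t != 0.
  by apply/eqP => p0; move: (cmod_polar t (ltW r0)) (r0); rewrite p0 cmod_normc
    ComplexField.Normc.normc0 => <-; rewrite ltxx.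
rewrite E !cpow_polarE// cmod_polar ?(ltW r0)// carg_polar//; last 2 first.
  by rewrite /t; lra.
  by rewrite /t; lra.
rewrite conjc_cexp.
have -> : (a `^ nu)%:C = cexp ((nu * ln a) +i* 0).
  apply/eqP; rewrite eq_complex /cexp/= cos0 sin0 /powR (gt_eqF a0).
  by rewrite !(mulr0, mul0r, subr0, addr0, mulr1) !eqxx.
rewrite -!cexpD; congr cexp; apply/eqP; rewrite eq_complex/=.
rewrite /r !lnM ?posrE ?mulr_gt0 ?cmod_gt0//.
by apply/andP; split; apply/eqP; rewrite /t; ring.
Qed.

End ComplexPowers.

(** * Matching the constants *)

Section Normalization.
Context {R : realType}.
Implicit Types (alpha nu : R) (e z : R[i]).

Lemma powR_invl (a nu : R) : 0 <= a -> a^-1 `^ nu = (a `^ nu)^-1.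
Proof. by move=> a0; rewrite -powR_inv1// -powRrM mulN1r powRN. Qed.

(** The factor [3^nu / 2] converts [2 (alpha |u| / 6)^nu], native to the mixture formula, into the
    [(alpha |u| / 2)^nu] of the integrand. *)
Lemma normalizing_const alpha nu : 0 < alpha ->
  alpha ^+ 2 / (3 * pi * 2 `^ (3 + nu)) * (2 `^ (- nu) * mixing_const alpha nu)
    * (3 `^ nu / 2) = 1.
Proof.
move=> a0; rewrite /mixing_const.
have n2 : 2 != 0 :> R by rewrite pnatr_eq0.
have q0 : 3 / 4 != 0 :> R by rewrite mulf_neq0 ?invr_eq0 ?pnatr_eq0.
have -> : 2 `^ (3 + nu) = 8 * 2 `^ nu :> R.
  rewrite powRD ?n2 ?implybT//; congr (_ * _).
  by rewrite powR_mulrn//; ring.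
have -> : (3 / 4) `^ (- (nu + 1)) = 4 / 3 * (2 `^ nu) ^+ 2 / 3 `^ nu :> R.
  rewrite powRN powRD ?q0 ?implybT// powRr1 ?divr_ge0// powRM ?invr_ge0//.
  rewrite powR_invl//.
  have -> : 4 `^ nu = (2 `^ nu) ^+ 2 :> R.
    by rewrite expr2 -powRM// -natrM.
  by field; rewrite !gt_eqF ?powR_gt0.
rewrite powRN.
have t0 : 2 `^ nu != 0 :> R by rewrite gt_eqF// powR_gt0.
have h0 : 3 `^ nu != 0 :> R by rewrite gt_eqF// powR_gt0.
have p0 : pi != 0 :> R by rewrite gt_eqF// pi_gt0.
move: (pi : R) p0 => p p0; field.
by rewrite t0 h0 p0 (gt_eqF a0).
Qed.

Lemma Re_weighted_integrand alpha nu e z (p : R * R) : 0 < alpha -> p != (0, 0) ->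
  let u := p.1 +i* p.2 in
  complex.Re (e * (cpow (sqrtc u) nu
    * (((alpha / 2) `^ nu)%:C * conjc (cpow (sqrtc u) nu)
       * besselI_even nu ((alpha / 2)%:C * (sqrtc z * conjc (sqrtc u))))
    * (expR (- (6^-1 * alpha * complex.Re u)))%:C
    * (besselK nu (alpha * cmod u / 3))%:C)) =
  Re_bessel_even alpha nu z (e * (3 `^ nu / 2)%:C) p * weight_besselK alpha nu p.
Proof.
move=> a0 p0 u.
have u0 : u != 0.
  rewrite eq_complex/=; apply: contra p0; case: p {u} => x y /=.
  by rewrite xpair_eqE.
rewrite /Re_bessel_even /weight_besselK /bessel_arg -/u.
set B := besselI_even _ _.
have -> : (alpha * cmod u / 3 / 2) `^ nu = (alpha / 2) `^ nu * cmod u `^ nu / 3 `^ nu.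
  have -> : alpha * cmod u / 3 / 2 = alpha / 2 * cmod u * 3^-1 by ring.
  have h0 : 0 <= alpha / 2 by rewrite divr_ge0// ltW.
  rewrite powRM ?invr_ge0//; last by rewrite mulr_ge0 ?cmod_ge0.
  by rewrite powR_invl// powRM ?cmod_ge0.
have -> : e * (cpow (sqrtc u) nu * (((alpha / 2) `^ nu)%:C * conjc (cpow (sqrtc u) nu) * B)
    * (expR (- (6^-1 * alpha * complex.Re u)))%:C * (besselK nu (alpha * cmod u / 3))%:C) =
  e * B * ((cmod u `^ nu) * (alpha / 2) `^ nu * expR (- (6^-1 * alpha * complex.Re u))
    * besselK nu (alpha * cmod u / 3))%:C.
  by rewrite !rmorphM/= -cpow_mul_conj//; ring.
rewrite [e * _ * B]mulrAC !Re_mul_real /=.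
by field; rewrite gt_eqF ?powR_gt0.
Qed.

End Normalization.

(* z^(nu/2) and u^(nu/2) are (sqrt z)^nu and (sqrt u)^nu; sqrt (z * conj u) is
   sqrt z * conj (sqrt u), whose argument lies in ]-pi, pi[, so that its
   principal nu-th power is (sqrt z)^nu * conj ((sqrt u)^nu).
   The second half is the identity after cancellation of z^(nu/2); it carries
   the content at z = 0, where the first half is degenerate when nu <> 0. *)
Theorem mainTheorem4 (R : realType) (alpha nu : R)
    (halpha : 0 < alpha) (hnu : -1 < nu) (z : R[i]) :
  let c : R := alpha ^+ 2 / (3 * pi * 2 `^ (3 + nu)) in
  let F (u : R[i]) : R[i] :=
    cpow (sqrtc u) nu
    * besselI nu ((alpha / 2)%:C * (sqrtc z * conjc (sqrtc u)))
    * (expR (- (6^-1 * alpha * complex.Re u)))%:C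
    * (besselK nu (alpha * cmod u / 3))%:C in
  let G (u : R[i]) : R[i] :=
    cpow (sqrtc u) nu
    * (((alpha / 2) `^ nu)%:C * conjc (cpow (sqrtc u) nu)
       * besselI_even nu ((alpha / 2)%:C * (sqrtc z * conjc (sqrtc u))))
    * (expR (- (6^-1 * alpha * complex.Re u)))%:C
    * (besselK nu (alpha * cmod u / 3))%:C in
  (cintegrable F /\
   cexp (- (alpha%:C * z / 4)) * cpow (sqrtc z) nu = c%:C * cintegral F) /\
  (cintegrable G /\
   cexp (- (alpha%:C * z / 4)) = c%:C * cintegral G).
Proof.
set c := alpha ^+ 2 / (3 * pi * 2 `^ (3 + nu)) => /=.
set F := fun u : R[i] => cpow (sqrtc u) nu * besselI nu _ * _ * _.
set G := fun u : R[i] => _ * (_ * besselI_even nu _) * _ * _.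
(* Taking [e = k] and [e = - i k] below yields the real and imaginary parts of the identity
   multiplied by [k]. *)
have ReG e : planar_measure.-integrable setT
      (fun p => (complex.Re (e * G (p.1 +i* p.2)))%:E) /\
    c * \int[planar_measure]_p complex.Re (e * G (p.1 +i* p.2)) =
      complex.Re (e * cexp (- (alpha%:C * z / 4))).
  have key := @integral_besselI_weight R alpha nu z halpha hnu
    (e * (3 `^ nu / 2)%:C) (fun p => complex.Re (e * G (p.1 +i* p.2))).
  have [|ig ->] := key.
    move=> p p0; exact: Re_weighted_integrand.
  split; first exact: ig.
  rewrite [e * _ * cexp _]mulrAC Re_mul_real; set X := complex.Re _.
  transitivity (c * (2 `^ (- nu) * mixing_const alpha nu) * (3 `^ nu / 2) * X); first by ring.
  by rewrite normalizing_const// mul1r.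
have ImE (w : R[i]) : complex.Im w = complex.Re (- 'i%C * w) by case: w => x y /=; ring.
(* Covers both halves: [k = 1] for [G], and [k = (sqrt z)^nu] for [F]. *)
have scaled (k : R[i]) (H : R[i] -> R[i]) : (forall u, H u = k * G u) ->
    cintegrable H /\ k * cexp (- (alpha%:C * z / 4)) = c%:C * cintegral H.
  move=> HE; have [i1 e1] := ReG k; have [i2 e2] := ReG (- 'i%C * k).
  have E1 p : complex.Re (H (p.1 +i* p.2)) = complex.Re (k * G (p.1 +i* p.2)).
    by rewrite HE.
  have E2 p : complex.Im (H (p.1 +i* p.2)) = complex.Re (- 'i%C * k * G (p.1 +i* p.2)).
    by rewrite HE ImE mulrA.
  split; first by split; [under eq_fun do rewrite E1|under eq_fun do rewrite E2].
  have r1 : c * \int[planar_measure]_p complex.Re (H (p.1 +i* p.2)) =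
      complex.Re (k * cexp (- (alpha%:C * z / 4))).
    by rewrite -e1; congr (_ * _); apply: eq_Rintegral => p _; rewrite E1.
  have r2 : c * \int[planar_measure]_p complex.Im (H (p.1 +i* p.2)) =
      complex.Im (k * cexp (- (alpha%:C * z / 4))).
    by rewrite ImE mulrA -e2; congr (_ * _); apply: eq_Rintegral => p _; rewrite E2.
  apply/eqP; rewrite eq_complex /cintegral -r1 -r2 /=.
  by rewrite !mul0r subr0 addr0 !eqxx.
split; last by have := scaled 1 G (fun u => esym (mul1r _)); rewrite mul1r.
(* For [z = 0] and [nu != 0], [cpow 0 nu = 0] makes both sides vanish, whatever the sign of [nu]. *)
have [/andP[/eqP z0 nu0]|zn] := boolP ((z == 0) && (nu != 0)).
  have F0 u : F u = 0.
    by rewrite /F /besselI z0 sqrtc0 mul0r mulr0 /cpow eqxx (negbTE nu0) !(mul0r, mulr0).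
  have -> : cexp (- (alpha%:C * z / 4)) * cpow (sqrtc z) nu = 0.
    by rewrite z0 sqrtc0 /cpow eqxx (negbTE nu0) mulr0.
  split.
    by split; under eq_fun do rewrite F0; exact: integrable0.
  have I0 : \int[@planar_measure R]_p (0 : R) = 0 by rewrite /Rintegral integral0.
  rewrite /cintegral.
  under eq_Rintegral do rewrite F0 /=.
  under [X in _ +i* X]eq_Rintegral do rewrite F0 /=.
  by rewrite I0 mulr0.
have := scaled (cpow (sqrtc z) nu) F; rewrite mulrC; apply => u.
(* It remains to see that [F] is [(sqrt z)^nu] times [G] pointwise. For [nu = 0] all powers are 1,
   even at the origin; for [nu != 0] and [u = 0] the leading [cpow] annihilates both sides. *)
rewrite /F /G /besselI; have [nu0|nu0] := eqVneq nu 0.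
  by rewrite nu0 !cpow0r powRr0 conjc1 !mul1r.
have {zn} z0 : z != 0 by move: zn; rewrite nu0 andbT.
have [->|u0] := eqVneq u 0.
  by rewrite sqrtc0 /cpow eqxx (negbTE nu0) !mul0r mulr0.
rewrite cpow_arg_mul ?divr_gt0//; ring.
Qed.
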